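(* Let $N,M\ge 1$ be integers and let $\mathcal{A}$ be the bounded operator on $L^2([0,1]^N,\mathbb{C}^M)$ given by $$\mathcal{A}\mathbf{u}=\mathbf{A}_0\mathbf{u}+\mathbf{A}_1\langle \mathbf{B}_1\mathbf{u}\rangle_1+\dots+\mathbf{A}_N\langle \mathbf{B}_N\mathbf{u}\rangle_N ,$$ where $\mathbf{A}_0$ ($M\times M$), $\mathbf{A}_j$ ($M\times M_j$), $\mathbf{B}_j$ ($M_j\times M$), $j=1,\dots,N$, are continuous matrix-valued functions on $[0,1]^N$ and $M_j$ are positive integers. Then the following procedure decides whether $\mathcal{A}$ is invertible. Step 0. Put $\mathbf{E}_0=\mathbf{A}_0$, $\pi_0=\det\mathbf{E}_0$. If $\pi_0(\mathbf{k}^0)=0$ for some $\mathbf{k}^0\in[0,1]^N$, then $\mathcal{A}$ is non-invertible. Otherwise define $\mathbf{A}_{i0}=\mathbf{A}_0^{-1}\mathbf{A}_i$ for $i=1,\dots,N$. Step $j$ ($j=1,\dots,N-1$, performed if no previous step terminated). Put $\mathbf{E}_j=\mathbf{I}+\langle\mathbf{B}_j\mathbf{A}_{j,j-1}\rangle_j$ and $\pi_j=\det\mathbf{E}_j$ (functions of $(k_{j+1},\dots,k_N)\in[0,1]^{N-j}$). If $\pi_j(\mathbf{k}_j^0)=0$ for some $\mathbf{k}_j^0\in[0,1]^{N-j}$, then $\mathcal{A}$ is non-invertible. Otherwise define $$\mathbf{A}_{ij}=\mathbf{A}_{i,j-1}-\mathbf{A}_{j,j-1}\mathbf{E}_j^{-1}\langle\mathbf{B}_j\mathbf{A}_{i,j-1}\rangle_j,\qquad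 i=j+1,\dots,N.$$ Step $N$ (performed if no previous step terminated). Put $\mathbf{E}_N=\mathbf{I}+\langle\mathbf{B}_N\mathbf{A}_{N,N-1}\rangle_N$ and $\pi_N=\det\mathbf{E}_N\in\mathbb{C}$. If $\pi_N=0$, then $\mathcal{A}$ is non-invertible; otherwise $\mathcal{A}$ is invertible.
   Context: For $1\le j\le N$, $\langle\cdot\rangle_j:=\int_{[0,1]^j}\cdot\;dk_1\cdots dk_j$ (applied entrywise to scalar-, vector- or matrix-valued functions of $\mathbf{k}=(k_1,\dots,k_N)\in[0,1]^N$); the result depends only on $(k_{j+1},\dots,k_N)$ and is regarded also as a function on $[0,1]^N$ that is constant in $k_1,\dots,k_j$. Invertible means invertible as a bounded linear operator on the Hilbert space $L^2([0,1]^N,\mathbb{C}^M)$. $\mathbf{I}$ is the identity matrix of the appropriate size. *)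

(* Defs.v *)
From HB Require Import structures.
From mathcomp Require Import all_boot all_order all_algebra.
From mathcomp Require Import complex.
From mathcomp Require Import all_classical all_reals all_analysis.

Set Implicit Arguments.
Unset Strict Implicit.
Unset Printing Implicit Defensive.

Import Order.TTheory GRing.Theory Num.Theory.
Import numFieldTopology.Exports numFieldNormedType.Exports.

Local Open Scope classical_set_scope.
Local Open Scope ring_scope.

(* Declared as a numClosedFieldType so that the topology which the analysis
   library puts on numeric fields (and on matrices over them) applies. *)
Definition Cplx (R : realType) : numClosedFieldType := R[i]%C.

Section LebesgueMeasure.
Context {R : realType}.

Definition cons_pair n (p : R * n.-tuple R) : n.+1.-tuple R :=
  [tuple of p.1 :: p.2].

Lemma measurable_cons_pair n : measurable_fun setT (@cons_pair n).
Proof. exact: measurable_cons. Qed.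

Section ConsMeasure.
Variables (n : nat) (mu : {sigma_finite_measure set (n.-tuple R) -> \bar R}).

Definition cons_measure : set (n.+1.-tuple R) -> \bar R :=
  pushforward (lebesgue_measure \x mu)%E (@cons_pair n).

Let measurable_preimage_cons_pair A :
  measurable A -> measurable (@cons_pair n @^-1` A).
Proof.
by move=> mA; rewrite -[X in measurable X]setTI; exact: measurable_cons_pair.
Qed.

Let cons_measure0 : cons_measure set0 = 0%E.
Proof. by rewrite /cons_measure /pushforward preimage_set0 measure0. Qed.

Let cons_measure_ge0 A : (0 <= cons_measure A)%E.
Proof. by rewrite /cons_measure /pushforward; apply: measure_ge0. Qed.

Let cons_measure_sigma_additive : semi_sigma_additive cons_measure.
Proof.
move=> F mF tF mUF; rewrite /cons_measure /pushforward preimage_bigcup.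
apply: measure_semi_sigma_additive.
- by move=> i; exact: measurable_preimage_cons_pair.
- apply/trivIsetP => /= i j _ _ ij; rewrite -preimage_setI.
  by move/trivIsetP : tF => /(_ _ _ _ _ ij) ->//; rewrite preimage_set0.
- by rewrite -preimage_bigcup; exact: measurable_preimage_cons_pair.
Qed.

HB.instance Definition _ := isMeasure.Build _ _ _ cons_measure
  cons_measure0 cons_measure_ge0 cons_measure_sigma_additive.

Lemma cons_measure_sigma_finite : sigma_finite setT cons_measure.
Proof.
have /sigma_finiteP[F [TF ndF Foo]] := sigma_finiteT (@lebesgue_measure R).
have /sigma_finiteP[G [TG ndG Goo]] := sigma_finiteT mu.
pose unc (t : n.+1.-tuple R) : R * n.-tuple R := (thead t, [tuple of behead t]).
have uncK t : cons_pair (unc t) = t by rewrite [RHS]tuple_eta; apply/val_inj.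
have cK : cancel (@cons_pair n) unc.
  by move=> [a t]; rewrite /unc /cons_pair /=; congr pair; apply/val_inj.
have munc : measurable_fun setT unc.
  by apply/measurable_fun_pairP; split;
    [exact: measurable_tnth|exact: measurable_behead].
exists (fun i => unc @^-1` (F i `*` G i)).
  rewrite -preimage_bigcup (_ : \bigcup_i _ = setT) ?preimage_setT//.
  apply/seteqP; split=> // -[x y] _.
  have : [set: R] x by []. rewrite TF => -[i _ Fix].
  have : [set: n.-tuple R] y by []. rewrite TG => -[k _ Gky].
  exists (maxn i k) => //; split => /=.
    by move: x Fix; apply/subsetPset/ndF/leq_maxl.
  by move: y Gky; apply/subsetPset/ndG/leq_maxr.
move=> i; have [mF Fi] := Foo i; have [mG Gi] := Goo i.
have mFG : measurable (F i `*` G i) by exact: measurableX.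
split; first by rewrite -[X in measurable X]setTI; exact: munc.
rewrite /cons_measure /pushforward (_ : _ @^-1` _ = F i `*` G i).
  rewrite product_measure1E// lte_mul_pinfty// ge0_fin_numE//.
by apply/seteqP; split=> p; rewrite /preimage /mkset cK.
Qed.

HB.instance Definition _ :=
  Measure_isSigmaFinite.Build _ _ _ cons_measure cons_measure_sigma_finite.

End ConsMeasure.

(* Lebesgue measure on R^n *)
Fixpoint leb n : {sigma_finite_measure set (n.-tuple R) -> \bar R} :=
  match n with
  | 0 => \d_([tuple] : 0.-tuple R)
  | n'.+1 => cons_measure (leb n')
  end.

End LebesgueMeasure.

Section Cube.
Context {R : realType}.
Local Notation C := (Cplx R).

Definition cube {n} : set (n.-tuple R) := [set k | forall i, 0 <= tnth k i <= 1].

(* Tuples carry the measurable structure and row vectors the topology. *)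
Definition continuous_on_cube N p q (F : N.-tuple R -> 'M[C]_(p, q)) : Prop :=
  {within [set x : 'rV[R]_N | cube [tuple x 0 i | i < N]],
    continuous (fun x : 'rV[R]_N => F [tuple x 0 i | i < N])}.

Definition cube_integral n (f : n.-tuple R -> C) : C :=
  Complex (\int[leb n]_(t in cube) complex.Re (f t))
          (\int[leb n]_(t in cube) complex.Im (f t)).

(* (k_1, ..., k_N) with its first j entries replaced by those of t *)
Definition set_prefix j N (t : j.-tuple R) (k : N.-tuple R) : N.-tuple R :=
  [tuple nth (tnth k i) t i | i < N].

(* <F>_j, as a function on the whole of [0,1]^N *)
Definition avg N p q (j : nat) (F : N.-tuple R -> 'M[C]_(p, q)) :
    N.-tuple R -> 'M[C]_(p, q) :=
  fun k => \matrix_(a, b) cube_integral (fun t : j.-tuple R => F (set_prefix t k) a b).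

End Cube.

(* The Hilbert space L^2([0,1]^N, C^M), presented by representatives: functions
   satisfying [L2], up to equality almost everywhere on the cube. *)
Section L2.
Context {R : realType} {N M : nat}.
Local Notation C := (Cplx R).
Local Notation vfun := (N.-tuple R -> 'cV[C]_M).

Definition eqL2 (u v : vfun) : Prop := u = v %[ae leb N in cube].

Definition cV_norm (x : 'cV[C]_M) : R :=
  Num.sqrt (\sum_(i < M) (complex.Re (x i 0) ^+ 2 + complex.Im (x i 0) ^+ 2)).

Definition L2norm (u : vfun) : \bar R :=
  'N[leb N]_2%:E[(fun k => (cV_norm (u k))%:E) \_ cube].

Definition L2 (u : vfun) : Prop :=
  (forall i, measurable_fun cube (fun k => complex.Re (u k i 0)) /\
             measurable_fun cube (fun k => complex.Im (u k i 0))) /\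
  (L2norm u < +oo)%E.

Definition bounded_operator (T : vfun -> vfun) : Prop :=
  [/\ forall u, L2 u -> L2 (T u),
      forall u v, L2 u -> L2 v -> eqL2 u v -> eqL2 (T u) (T v),
      forall (a : C) u v, L2 u -> L2 v ->
        eqL2 (T (fun k => a *: u k + v k)) (fun k => a *: T u k + T v k) &
      exists c : R, forall u, L2 u -> (L2norm (T u) <= c%:E * L2norm u)%E].

Definition invertible (T : vfun -> vfun) : Prop :=
  exists2 S : vfun -> vfun, bounded_operator S &
    forall u, L2 u -> eqL2 (S (T u)) u /\ eqL2 (T (S u)) u.

End L2.

(* The families (A_j) and (B_j) are indexed from 1 to N; their values at other
   indices are never used. *)
Section Procedure.
Context {R : realType} {N M : nat} (m : nat -> nat).
Local Notation C := (Cplx R).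
Local Notation mfun p q := (N.-tuple R -> 'M[C]_(p, q)).
Variables (A0 : mfun M M) (A : forall j, mfun M (m j)) (B : forall j, mfun (m j) M).

Definition calA (u : mfun M 1) : mfun M 1 := fun k =>
  A0 k *m u k +
  \sum_(1 <= j < N.+1) A j k *m avg j (fun k' => B j k' *m u k') k.

Definition step_mx (j : nat) (X : mfun M (m j)) : mfun (m j) (m j) :=
  fun k => 1%:M + avg j (fun k' => B j k' *m X k') k.

(* [reduced i j] is A_{ij}. *)
Fixpoint reduced (i j : nat) {struct j} : mfun M (m i) :=
  match j with
  | 0 => fun k => invmx (A0 k) *m A i k
  | j'.+1 => fun k =>
      reduced i j' k -
      reduced j'.+1 j' k *m invmx (step_mx (reduced j'.+1 j') k)
        *m avg j'.+1 (fun k' => B j'.+1 k' *m reduced i j' k') k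
  end.

(* pi_j = det E_j, with E_0 = A_0 *)
Definition step_det (j : nat) (k : N.-tuple R) : C :=
  match j with
  | 0 => \det (A0 k)
  | j'.+1 => \det (step_mx (reduced j'.+1 j') k)
  end.

Definition step_stops (j : nat) : Prop :=
  exists2 k, cube k & step_det j k = 0.

End Procedure.

(* Main.v *)
(* Write <.>_j for averaging over the first j variables. Since <.>_i is constant
   in k_1, ..., k_i, the operator factors on L^2 as A_0 P_1 ... P_j Q_j, where
   P_j u = u + A_{j,j-1} <B_j u>_j and Q_j u = u + sum_{i > j} A_{ij} <B_i u>_i.
   By the Woodbury formula P_j is inverted by u - A_{j,j-1} E_j^-1 <B_j u>_j as
   soon as det E_j vanishes nowhere on the compact cube, and Q_N = 1; hence
   invertibility when no step stops. If the first singular matrix is E_j at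
   k^0, say E_j(k^0) v = 0, take u = f A_{j,j-1} v (u = f v if j = 0), where f is the indicator of
   a box of size d around k^0 in the variables k_{j+1}, ..., k_N. Then
   Q_{j-1} u = f A_{j,j-1} E_j v + sum_{i > j} A_{i,j-1} <B_i u>_i; the first
   term is small by continuity, and each average over i > j variables is
   O(d^(1/2)) |f| in L^2 because it integrates over k_{j+1}. As |u| is bounded
   below by a multiple of |f|, the operator is not bounded below. *)
From HB Require Import structures.
Require Import Defs.
From mathcomp Require Import all_boot all_order all_algebra.
From mathcomp Require Import complex.
From mathcomp Require Import all_classical all_reals all_analysis.
From mathcomp Require Import measurable_realfun.
From mathcomp Require Import ring lra.

Set Implicit Arguments.
Unset Strict Implicit.
Unset Printing Implicit Defensive.

Import Order.TTheory GRing.Theory Num.Theory.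
Import numFieldTopology.Exports numFieldNormedType.Exports.

Local Open Scope classical_set_scope.
Local Open Scope ring_scope.

(** * Tonelli on the cube *)

(** An average is a Lebesgue integral of a representative along a slice; on a slice that is not
    integrable it takes a default value and linearity may fail. Each operator identity is therefore
    checked at the points [k] whose slice is integrable, which for a square integrable function are
    almost all points by Tonelli, and operators must respect equality almost everywhere before they
    can be composed; [regular_op] records this. Estimates use the squared norm [energy], with values
    in the extended reals. In the singular case with j >= 1, the lower bound on |u| comes from <B_j
    u>_j = f (E_j v - v): near k^0 this is close to - f v, and u -> <B_j u>_j is bounded. Smallness
    of Q_{j-1} u passes to the whole operator because A_0 P_1 ... P_{j-1} is bounded. The box leaves
    k_1, ..., k_j free so that f can be taken out of averages over these variables; its volume is a
    common factor of all estimates and cancels at the end. *)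

Section TonelliOnRectangles.
Local Open Scope ereal_scope.
Context d1 d2 (T1 : measurableType d1) (T2 : measurableType d2) (R : realType).
Variables (m1 : {sigma_finite_measure set T1 -> \bar R})
  (m2 : {sigma_finite_measure set T2 -> \bar R}).
Variables (D1 : set T1) (D2 : set T2) (f : T1 * T2 -> \bar R).
Hypotheses (mD1 : measurable D1) (mD2 : measurable D2)
  (mf : measurable_fun (D1 `*` D2) f)
  (f0 : forall z, (D1 `*` D2) z -> 0 <= f z).

(** Extension by zero turns integrals over the rectangle into integrals over the whole product,
    where Tonelli applies. *)
Let g := f \_ (D1 `*` D2).

Let mg : measurable_fun setT g.
Proof. by apply/(measurable_restrictT _ _).1 => //; exact: measurableX. Qed.

Let g0 z : 0 <= g z.
Proof. by apply: erestrict_ge0 => z' /f0. Qed.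

Let gE x y : g (x, y) = if x \in D1 then ((fun y => f (x, y)) \_ D2) y else 0.
Proof. by rewrite /g !patchE in_setX /=; case: (x \in D1). Qed.

Let FE x : fubini_F m2 g x = ((fun x => \int[m2]_(y in D2) f (x, y)) \_ D1) x.
Proof.
rewrite /fubini_F patchE; under eq_integral do rewrite gE.
by case: ifP => _; rewrite ?integral0// -integral_mkcond.
Qed.

Let GE y : fubini_G m1 g y = ((fun y => \int[m1]_(x in D1) f (x, y)) \_ D2) y.
Proof.
rewrite /fubini_G patchE.
under eq_integral do rewrite /g patchE in_setX /= andbC.
case: ifP => yD /=; last by rewrite integral0.
by rewrite [RHS]integral_mkcond; apply: eq_integral => x _; rewrite patchE.
Qed.

Lemma measurable_fun_rectangle_integral :
  measurable_fun D1 (fun x => \int[m2]_(y in D2) f (x, y)).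
Proof.
apply/(measurable_restrictT _ _).2 => //.
by rewrite -(funext FE); exact: measurable_fun_fubini_tonelli_F.
Qed.

Lemma tonelli_rectangle1 : \int[m1 \x m2]_(z in D1 `*` D2) f z =
  \int[m1]_(x in D1) \int[m2]_(y in D2) f (x, y).
Proof.
rewrite integral_mkcond (fubini_tonelli1 _ mg g0) [RHS]integral_mkcond.
by apply: eq_integral => x _; rewrite -FE.
Qed.

Lemma tonelli_rectangle : \int[m1]_(x in D1) \int[m2]_(y in D2) f (x, y) =
  \int[m2]_(y in D2) \int[m1]_(x in D1) f (x, y).
Proof.
rewrite -tonelli_rectangle1 integral_mkcond (fubini_tonelli2 _ mg g0).
by rewrite [RHS]integral_mkcond; apply: eq_integral => x _; rewrite -GE.
Qed.

End TonelliOnRectangles.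

(** * Boxes, the cube, and overwriting the first variables *)

Section CubeMeasure.
Context {R : realType}.
Implicit Types (n j : nat).

Definition box n (J : 'I_n -> set R) : set (n.-tuple R) :=
  [set k | forall i, J i (tnth k i)].

Lemma measurable_box n (J : 'I_n -> set R) :
  (forall i, measurable (J i)) -> measurable (box J).
Proof.
move=> mJ; rewrite (_ : box J = \bigcap_(i in [set: 'I_n]) ((fun k => tnth k i) @^-1` J i)).
  apply: fin_bigcap_measurable => // i _.
  by rewrite -[X in measurable X]setTI; exact: measurable_tnth.
by apply/seteqP; split => [k Jk i _|k Jk i]; [exact: Jk|exact: Jk].
Qed.

Lemma cubeE n : cube = box (fun _ : 'I_n => `[0, 1]%classic : set R).
Proof.
by apply/seteqP; split => k kc i; move: (kc i); rewrite /= in_itv.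
Qed.

Lemma measurable_cube n : measurable (cube : set (n.-tuple R)).
Proof. by rewrite cubeE; exact: measurable_box. Qed.

Lemma box_consE n (J : 'I_n.+1 -> set R) :
  @cons_pair R n @^-1` box J = J ord0 `*` box (fun i => J (lift ord0 i)).
Proof.
apply/seteqP; split => [[x k] /= Jk|[x k] [/= J0 Jk] i].
  by split => [|i]; [have := Jk ord0|have := Jk (lift ord0 i)]; rewrite ?tnth0 ?tnthS.
by case: (unliftP ord0 i) => [i' ->|->]; rewrite ?tnth0 ?tnthS.
Qed.

Lemma cube_consE n : @cons_pair R n @^-1` cube = `[0, 1]%classic `*` cube.
Proof. by rewrite !cubeE box_consE. Qed.

Lemma cube_cons n x (t : n.-tuple R) :
  cube (cons_pair (x, t)) = (`[0, 1]%classic `*` cube) (x, t).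
Proof. by rewrite -cube_consE. Qed.

Lemma leb_box n (J : 'I_n -> set R) : (forall i, measurable (J i)) ->
  leb n (box J) = (\prod_i lebesgue_measure (J i))%E.
Proof.
elim: n J => [|n IH] J mJ.
  rewrite big_ord0 /= diracE mem_set//.
  by case.
rewrite big_ord_recl -IH// [LHS]/= /cons_measure /pushforward box_consE.
by rewrite product_measure1E//; [exact: mJ|apply: measurable_box].
Qed.

Lemma leb_cube n : leb n (cube : set (n.-tuple R)) = 1%E.
Proof.
rewrite cubeE leb_box//; apply: big1 => i _.
by rewrite lebesgue_measure_itv /= lte_fin ltr01 oppr0 adde0.
Qed.

(** The measure [leb n.+1] is the image of a product measure under [cons_pair], and the preimage of
    the cube is a rectangle; a change of variables followed by Tonelli gives the iterated
    integral. *)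
Lemma ge0_integral_cube_cons n (f : n.+1.-tuple R -> \bar R) :
  measurable_fun cube f -> (forall k, cube k -> (0 <= f k)%E) ->
  (\int[leb n.+1]_(k in cube) f k =
   \int[lebesgue_measure]_(x in `[0%R, 1%R])
     \int[leb n]_(t in cube) f (cons_pair (x, t)))%E.
Proof.
move=> mf f0.
have mc : measurable_fun setT
    (@cons_pair R n : (measurableTypeR R * n.-tuple R)%type -> _) :=
  @measurable_cons_pair R n.
have mC := @measurable_cube n.
have mC1 := @measurable_cube n.+1.
(* [lebesgue_measure] carries the measurable structure of [measurableTypeR R],
   which unification does not identify with the one of [R]. *)
pose P : {measure set (measurableTypeR R * n.-tuple R) -> \bar R} :=
  (lebesgue_measure \x leb n)%E.
transitivity
    (\int[P]_(x in cons_pair (n:=n) @^-1` cube) (f \o cons_pair (n:=n)) x)%E.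
  rewrite -(ge0_integral_pushforward mc P mC1 mf); last by move=> k /set_mem/f0.
  exact: eq_measure_integral.
rewrite cube_consE.
apply: (@tonelli_rectangle1 _ _ (measurableTypeR R) (n.-tuple R) R
  lebesgue_measure (leb n)) => //.
- apply: (@measurable_comp _ _ _ _ _ _ cube) => //.
    by move=> _ [z zc <-]; move: zc; rewrite -cube_consE.
  exact: measurable_funS mc.
- by move=> z zc; apply: f0; move: zc; rewrite -cube_consE.
Qed.

Lemma tnth_set_prefix j n (t : j.-tuple R) (k : n.-tuple R) i :
  tnth (set_prefix t k) i = nth (tnth k i) t i.
Proof. by rewrite tnth_mktuple. Qed.

Lemma set_prefix_cons j n x y (t : j.-tuple R) (k : n.-tuple R) :
  set_prefix (cons_pair (y, t)) (cons_pair (x, k)) = cons_pair (y, set_prefix t k).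
Proof.
apply: eq_from_tnth => i; rewrite tnth_set_prefix.
by case: (unliftP ord0 i) => [i' ->|->]; rewrite ?tnth0 ?tnthS//= tnth_set_prefix.
Qed.

Lemma set_prefix0 n (t : 0.-tuple R) (k : n.-tuple R) : set_prefix t k = k.
Proof.
by apply: eq_from_tnth => i; rewrite tnth_set_prefix tuple0 nth_nil.
Qed.

Lemma cube_set_prefix j n (t : j.-tuple R) (k : n.-tuple R) :
  cube t -> cube k -> cube (set_prefix t k).
Proof.
move=> ct ck i; rewrite tnth_set_prefix.
have [ij|ij] := ltnP i j; last by rewrite nth_default ?size_tuple.
by rewrite -(tnth_nth _ t (Ordinal ij)).
Qed.

Lemma measurable_set_prefix2 j n : measurable_fun setT
  (fun p : n.-tuple R * j.-tuple R => set_prefix p.2 p.1).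
Proof.
apply/measurable_fun_tnthP => i.
have [ij|ij] := ltnP i j.
  rewrite (_ : _ \o _ = (fun t => tnth t (Ordinal ij)) \o snd).
    by apply: measurableT_comp => //; exact: measurable_tnth.
  by apply/funext => p /=; rewrite tnth_set_prefix [RHS](tnth_nth (tnth p.1 i)).
rewrite (_ : _ \o _ = (fun t => tnth t i) \o fst).
  by apply: measurableT_comp => //; exact: measurable_tnth.
by apply/funext => p /=; rewrite tnth_set_prefix nth_default ?size_tuple.
Qed.

Lemma measurable_set_prefix j n (k : n.-tuple R) :
  measurable_fun setT (fun t : j.-tuple R => set_prefix t k).
Proof.
exact: (measurableT_comp (@measurable_set_prefix2 j n) (pair1_measurable k)).
Qed.

Section Prefix.
Context d (Y : measurableType d).

Lemma measurable_fun_set_prefix2 j n (f : n.-tuple R -> Y) : measurable_fun cube f ->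
  measurable_fun (cube `*` cube)
    (fun p : n.-tuple R * j.-tuple R => f (set_prefix p.2 p.1)).
Proof.
move=> mf; apply: (@measurable_comp _ _ _ _ _ _ cube) => //.
- exact: measurable_cube.
- by move=> _ [[k t] [kc tc] <-]; exact: cube_set_prefix.
- exact: measurable_funS (@measurable_set_prefix2 j n).
Qed.

Lemma measurable_fun_set_prefix j n (f : n.-tuple R -> Y) k :
  cube k -> measurable_fun cube f ->
  measurable_fun cube (fun t : j.-tuple R => f (set_prefix t k)).
Proof.
move=> kc mf; apply: (@measurable_comp _ _ _ _ _ _ cube) => //.
- exact: measurable_cube.
- by move=> _ [t tc <-]; exact: cube_set_prefix.
- exact: measurable_funS (@measurable_set_prefix j n k).
Qed.

End Prefix.

Lemma measurable_prefix_integral j n (f : n.-tuple R -> \bar R) :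
  measurable_fun cube f -> (forall k, cube k -> (0 <= f k)%E) ->
  measurable_fun cube
    (fun k => \int[leb j]_(t in cube) f (set_prefix t k))%E.
Proof.
move=> mf f0.
apply: (@measurable_fun_rectangle_integral _ _ _ _ _ (leb j) cube cube
   (fun p => f (set_prefix p.2 p.1))); try exact: measurable_cube.
- exact: measurable_fun_set_prefix2.
- by move=> [k t] [kc tc]; apply: f0; exact: cube_set_prefix.
Qed.

(** After the overwriting, the first [j] coordinates of [k] are dummy variables of total mass 1, and
    those of [t] take their place. The induction peels one coordinate off both [k] and [t].
    Everything that compares a function with its slices rests on this identity. *)
Lemma ge0_integral_prefix j n (f : n.-tuple R -> \bar R) : (j <= n)%N ->
  measurable_fun cube f -> (forall k, cube k -> (0 <= f k)%E) ->
  (\int[leb n]_(k in cube) \int[leb j]_(t in cube) f (set_prefix t k) =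
   \int[leb n]_(k in cube) f k)%E.
Proof.
elim: j n f => [|j IH] [|n]// f jn mf f0; last first; [|clear jn..].
  pose I : set (measurableTypeR R) := `[0, 1]%classic.
  have mI : measurable I by exact: measurable_itv.
  have mC := @measurable_cube n; have mCj := @measurable_cube j.
  have mfc : measurable_fun ((cube `*` I) `*` cube)
      (fun z : ((n.-tuple R * measurableTypeR R) * j.-tuple R)%type =>
         f (cons_pair (z.1.2, set_prefix z.2 z.1.1))).
    apply: (@measurable_comp _ _ _ _ _ _ cube) => //.
    - exact: measurable_cube.
    - move=> _ [[[k y] t] [[/= kc yc] tc] <-]; rewrite cube_cons.
      by split => //; exact: cube_set_prefix.
    - apply: (measurable_funS _ (@subsetT _ _)) => //.
      apply: measurable_cons.
        exact: (measurableT_comp measurable_snd measurable_fst).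
      apply: (measurableT_comp (@measurable_set_prefix2 j n)
        (g := fun z : ((n.-tuple R * measurableTypeR R) * j.-tuple R)%type =>
           (z.1.1, z.2))).
      apply: measurable_fun_pair; last exact: measurable_snd.
      exact: (measurableT_comp measurable_fst measurable_fst).
  have fc0 y k t : I y -> cube k -> cube t ->
      (0 <= f (cons_pair (y, set_prefix t k)))%E.
    move=> yc kc tc; apply: f0; rewrite cube_cons; split => //.
    exact: cube_set_prefix.
  rewrite ge0_integral_cube_cons; first last.
    move=> k kc; apply: integral_ge0 => t tc; apply: f0; exact: cube_set_prefix.
    exact: measurable_prefix_integral.
  (* Once [y] has overwritten the first coordinate [x] of [k], nothing depends on [x], which
     contributes the length 1 of its interval. *)
  rewrite (@eq_integral _ _ _ lebesgue_measure _ (cst (\int[leb n]_(k in cube)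
     \int[lebesgue_measure]_(y in `[0%R, 1%R]) \int[leb j]_(t in cube)
       f (cons_pair (y, set_prefix t k)))%E)); last first.
    move=> x /set_mem xc; apply: eq_integral => k /set_mem kc.
    rewrite ge0_integral_cube_cons.
    - apply: eq_integral => y _; apply: eq_integral => t _.
      by rewrite set_prefix_cons.
    - by apply: measurable_fun_set_prefix => //; rewrite cube_cons.
    - by move=> t tc; apply: f0; apply: cube_set_prefix => //; rewrite cube_cons.
  rewrite integral_cst// [X in (_ * X)%E](_ : _ = 1%E) ?mule1; last first.
    by rewrite /= lebesgue_measure_itv /= lte_fin ltr01 oppr0 adde0.
  (* Moving [y] outside makes the induction hypothesis applicable to the slice of [f] at each fixed
     [y]. *)
  rewrite (@tonelli_rectangle _ _ _ (measurableTypeR R) R (leb n) lebesgue_measure cube I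
     (fun z => \int[leb j]_(t in cube) f (cons_pair (z.2, set_prefix t z.1)))%E)//; last first.
  - by move=> [k y] [kc yc]; apply: integral_ge0 => t tc; exact: fc0.
  - apply: (@measurable_fun_rectangle_integral _ _ _ _ _ (leb j) _ cube
      (fun z => f (cons_pair (z.1.2, set_prefix z.2 z.1.1)))) => //.
      exact: measurableX.
    by move=> [[k y] t] [[kc yc] tc]; exact: fc0.
  rewrite [RHS](ge0_integral_cube_cons mf f0); apply: eq_integral => y /set_mem yc.
  apply: (IH n (fun k => f (cons_pair (y, k)))) => //.
  - apply: (@measurable_comp _ _ _ _ _ _ cube) => //.
    + exact: measurable_cube.
    + by move=> _ [k kc <-]; rewrite cube_cons.
    + apply: (measurable_funS _ (@subsetT _ _)) => //.
      by apply: measurable_cons; [exact: measurable_cst|exact: measurable_id].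
  - by move=> k kc; apply: f0; rewrite cube_cons.
(* In both remaining goals [j = 0]: an empty prefix changes nothing, and the cube of dimension 0 has
   mass 1. *)
all: apply: eq_integral => k _.
all: under eq_integral do rewrite set_prefix0.
all: rewrite integral_cst; last exact: measurable_cube.
all: by rewrite [X in (_ * X)%E](leb_cube 0) mule1.
Qed.

End CubeMeasure.

(** * Continuous functions on the cube *)

Section Modulus.
Context {R : realType}.
Local Notation C := (Cplx R).
Implicit Types z w : C.

(** The norm of [Cplx R] takes its values in [Cplx R] itself; integrals and estimates need a real
    number. *)
Definition cabs z : R := complex.Re `|z|.

Lemma cabsE z : (cabs z)%:C%C = `|z|.
Proof. by rewrite /cabs RRe_real// normr_real. Qed.

Lemma cabsD z w : cabs (z + w) <= cabs z + cabs w.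
Proof. by rewrite -lecR rmorphD /= !cabsE; exact: ler_normD. Qed.

Lemma cabsN z : cabs (- z) = cabs z.
Proof. by rewrite /cabs normrN. Qed.

Lemma cabsB z w : cabs (z - w) = cabs (w - z).
Proof. by rewrite /cabs distrC. Qed.

Lemma cabsM z w : cabs (z * w) = cabs z * cabs w.
Proof. by apply: (@complexI R); rewrite rmorphM /= !cabsE normrM. Qed.

Lemma cabs0 : cabs 0 = 0.
Proof. by rewrite /cabs normr0. Qed.

Lemma cabs_ge0 z : 0 <= cabs z.
Proof. by rewrite -ler0c cabsE. Qed.

Lemma cabs_eq0 z : (cabs z == 0) = (z == 0).
Proof.
apply/eqP/eqP => [z0|->]; last exact: cabs0.
by apply: normr0_eq0; rewrite -cabsE z0.
Qed.

Lemma cabs_sqr z : cabs z ^+ 2 = complex.Re z ^+ 2 + complex.Im z ^+ 2.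
Proof.
by rewrite /cabs normc_def /= sqr_sqrtr ?addr_ge0 ?sqr_ge0.
Qed.

Lemma ler_Re_cabs z : `|complex.Re z| <= cabs z.
Proof.
rewrite -(@ler_pXn2r _ 2)// ?nnegrE ?cabs_ge0//.
by rewrite cabs_sqr real_normK ?num_real// lerDl sqr_ge0.
Qed.

Lemma ler_Im_cabs z : `|complex.Im z| <= cabs z.
Proof.
rewrite -(@ler_pXn2r _ 2)// ?nnegrE ?cabs_ge0//.
by rewrite cabs_sqr real_normK ?num_real// lerDr sqr_ge0.
Qed.

Lemma cabs_le_ReIm z : cabs z <= `|complex.Re z| + `|complex.Im z|.
Proof.
rewrite -(@ler_pXn2r _ 2)// ?nnegrE ?cabs_ge0 ?addr_ge0//.
rewrite cabs_sqr -(real_normK (num_real (complex.Re z))).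
rewrite -(real_normK (num_real (complex.Im z))).
have := normr_ge0 (complex.Re z); have := normr_ge0 (complex.Im z); nra.
Qed.

Lemma cReD z w : complex.Re (z + w) = complex.Re z + complex.Re w.
Proof. by case: z; case: w. Qed.

Lemma cImD z w : complex.Im (z + w) = complex.Im z + complex.Im w.
Proof. by case: z; case: w. Qed.

Lemma cReM z w : complex.Re (z * w) =
  complex.Re z * complex.Re w - complex.Im z * complex.Im w.
Proof. by case: z; case: w. Qed.

Lemma cImM z w : complex.Im (z * w) =
  complex.Re z * complex.Im w + complex.Im z * complex.Re w.
Proof. by case: z; case: w. Qed.

End Modulus.

Section Continuity.
Context {R : realType} {N : nat}.
Local Notation C := (Cplx R).
Implicit Types f g : N.-tuple R -> C.

Definition cubeV : set 'rV[R]_N := [set x | cube [tuple x 0 i | i < N]].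

Definition tuple_of_rV (x : 'rV[R]_N) : N.-tuple R := [tuple x 0 i | i < N].

Definition continuous_cube f : Prop := {within cubeV, continuous (f \o tuple_of_rV)}.

(** Closeness in the sup norm, written for tuples; [ball_dist_lt] identifies it with the balls of
    the row vectors that carry the topology. *)
Definition dist_lt (d : R) (k k' : N.-tuple R) : Prop :=
  forall i, `|tnth k i - tnth k' i| < d.

Lemma compact_cubeV : compact cubeV.
Proof.
rewrite (_ : cubeV = [set v : 'rV[R]_N | forall i, `[0, 1]%classic (v ord0 i)]).
  by apply: (@rV_compact R N (fun=> `[0, 1]%classic)) => i; exact: segment_compact.
by apply/seteqP; split => x xc i; have := xc i; rewrite /= tnth_mktuple in_itv.
Qed.

Lemma ball_dist_lt (d : R) (x y : 'rV[R]_N) : 0 < d ->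
  ball x d y <-> dist_lt d (tuple_of_rV x) (tuple_of_rV y).
Proof.
move=> d0; split => [[_ xy] i|xy].
  by have := xy ord0 i; rewrite !tnth_mktuple.
split => // i j; have := xy j; rewrite !tnth_mktuple (ord1 i).
by [].
Qed.

Lemma tuple_of_rVK (k : N.-tuple R) : tuple_of_rV (\row_i tnth k i) = k.
Proof. by apply: eq_from_tnth => i; rewrite tnth_mktuple mxE. Qed.

(** Compactness in its near-covering form, for the filter of small positive [r]. It yields uniform
    continuity, with [r] a modulus, as well as boundedness, with [r] the inverse of a bound. *)
Lemma cube_near_cover (P : R -> N.-tuple R -> Prop) :
  (forall k, cube k -> exists2 d, 0 < d &
    forall k', cube k' -> dist_lt d k k' -> forall r, 0 < r < d -> P r k') ->
  exists2 r, 0 < r & forall k, cube k -> P r k.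
Proof.
move=> loc.
have /compact_near_coveringP nc := compact_cubeV.
have [r [r0 rP]] : exists r : R, 0 < r /\ (cubeV `<=` fun x => cubeV x -> P r (tuple_of_rV x)).
  apply: (@filter_ex _ (at_right (0 : R)) _).
  apply: filterI; first exact: nbhs_right_gt.
  apply: (nc R (at_right 0) (fun r x => cubeV x -> P r (tuple_of_rV x)) _ _).
  move=> x xc.
  have [d d0 dP] := loc _ xc.
  exists (ball x d, [set r | 0 < r < d]) => /=.
    split; first exact: nbhsx_ballx.
    near=> r => /=; apply/andP; split; near: r; first exact: nbhs_right_gt.
    exact: nbhs_right_lt.
  move=> [y r] [/= yx rd] yc; apply: dP => //.
  by apply/ball_dist_lt.
exists r => // k kc; rewrite -(tuple_of_rVK k); apply: rP.
  by rewrite /cubeV /= -/(tuple_of_rV _) tuple_of_rVK.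
by rewrite /cubeV /= -/(tuple_of_rV _) tuple_of_rVK.
Unshelve. all: by end_near. Qed.

Lemma continuous_cubeP f : continuous_cube f <-> forall k, cube k -> forall e : R, 0 < e ->
  exists2 d, 0 < d &
    forall k', cube k' -> dist_lt d k k' -> cabs (f k - f k') < e.
Proof.
rewrite /continuous_cube subspace_continuousP; split.
  move=> fc k kc e e0.
  have kc' : cubeV (\row_i tnth k i).
    by rewrite /cubeV /= -/(tuple_of_rV _) tuple_of_rVK.
  have /cvgrPdist_lt /(_ e%:C%C) := fc _ kc'.
  rewrite ltcR => /(_ e0); rewrite near_withinE => /nbhs_ballP[d /= d0 dP].
  exists d => // k' k'c kk'.
  have := dP (\row_i tnth k' i); rewrite /from_subspace /= !tuple_of_rVK -cabsE ltcR; apply.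
    by apply/ball_dist_lt => //; rewrite !tuple_of_rVK.
  by rewrite /cubeV /= -/(tuple_of_rV _) tuple_of_rVK.
move=> fc x xc; apply/cvgrPdist_lt => e e0.
(* In the order of [C] a positive element is real. *)
have /complex_realP[r er] : e \is Num.real by exact: gtr0_real.
move: e0; rewrite er ltcR => r0.
have [d d0 dP] := fc _ xc _ r0.
rewrite near_withinE; apply/nbhs_ballP; exists d => //= y xy yc.
by rewrite /from_subspace /= -cabsE ltcR; apply: dP => //; apply/ball_dist_lt.
Qed.

Lemma continuous_cube_unif f : continuous_cube f -> forall e : R, 0 < e -> exists2 d, 0 < d &
  forall k k', cube k -> cube k' -> dist_lt d k k' -> cabs (f k - f k') < e.
Proof.
move=> /continuous_cubeP fc e e0.
have [|d d0 dP] := @cube_near_cover (fun d k => forall k', cube k' ->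
    dist_lt d k k' -> cabs (f k - f k') < e); last first.
  by exists d => // k k' kc k'c; exact: dP.
move=> k kc; have e20 : 0 < e / 2 by rewrite divr_gt0.
have [d d0 dP] := fc k kc _ e20.
exists (d / 2); first by rewrite divr_gt0.
move=> k1 k1c kk1 r /andP[r0 rd] k2 k2c k12.
rewrite -[_ - _](subrKA (f k)) [e]splitr.
apply: le_lt_trans (cabsD _ _) _; rewrite cabsB ltrD//; apply: dP => //.
  by move=> i; apply: lt_trans (kk1 i) _; lra.
move=> i; rewrite -[_ - _](subrKA (tnth k1 i)).
apply: le_lt_trans (ler_normD _ _) _.
by have := kk1 i; have := k12 i; lra.
Qed.

Lemma continuous_cube_bounded f : continuous_cube f ->
  exists2 K : R, 0 < K & forall k, cube k -> cabs (f k) <= K.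
Proof.
move=> /continuous_cubeP fc.
have [|r r0 rP] := @cube_near_cover (fun r k => cabs (f k) <= r^-1); last first.
  by exists r^-1 => //; rewrite invr_gt0.
move=> k kc; have [d d0 dP] := fc k kc 1 ltr01.
have K0 : 0 < cabs (f k) + 1 by rewrite ltr_wpDl ?cabs_ge0.
exists (Num.min d (cabs (f k) + 1)^-1); first by rewrite lt_min d0 invr_gt0.
move=> k' k'c kk' r /andP[r0]; rewrite lt_min => /andP[_ rd].
rewrite -(subrK (f k) (f k')) (le_trans (cabsD _ _))//.
rewrite (@le_trans _ _ (cabs (f k) + 1))//.
  rewrite addrC lerD2l cabsB ltW//; apply: dP => // i.
  by apply: lt_le_trans (kk' i) _; rewrite ge_min lexx.
by rewrite -[leLHS]invrK lef_pV2 ?posrE ?invr_gt0// ltW.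
Qed.

Lemma continuous_cube_cst (c : C) : continuous_cube (fun=> c).
Proof.
by apply/continuous_cubeP => k _ e e0; exists 1 => // k' _ _; rewrite subrr cabs0.
Qed.

Lemma continuous_cubeD f g : continuous_cube f -> continuous_cube g ->
  continuous_cube (fun k => f k + g k).
Proof. by move=> fc gc x; apply: continuousD; [exact: fc|exact: gc]. Qed.

Lemma continuous_cubeM f g : continuous_cube f -> continuous_cube g ->
  continuous_cube (fun k => f k * g k).
Proof. by move=> fc gc x; apply: continuousM; [exact: fc|exact: gc]. Qed.

Lemma continuous_cube_ext f g : (forall k, cube k -> f k = g k) ->
  continuous_cube f -> continuous_cube g.
Proof.
move=> fg /continuous_cubeP fc; apply/continuous_cubeP => k kc e /(fc k kc)[d d0 dP].
by exists d => // k' k'c kk'; rewrite -!fg//; exact: dP.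
Qed.

Lemma continuous_cubeV f : (forall k, cube k -> f k != 0) -> continuous_cube f ->
  continuous_cube (fun k => (f k)^-1).
Proof.
move=> f0 fc; rewrite /continuous_cube continuous_subspace_in => x /set_mem xc.
by apply: continuousV; [exact: f0|exact: fc].
Qed.

Lemma continuous_cube_sum I (r : seq I) (P : pred I) (F : I -> N.-tuple R -> C) :
  (forall i, P i -> continuous_cube (F i)) ->
  continuous_cube (fun k => \sum_(i <- r | P i) F i k).
Proof.
move=> Fc; elim: r => [|i r IH].
  apply: (@continuous_cube_ext (fun=> 0)) => [k _|]; first by rewrite big_nil.
  exact: continuous_cube_cst.
have [Pi|Pi] := boolP (P i).
  by apply: (continuous_cube_ext _ (continuous_cubeD (Fc i Pi) IH)) => k _; rewrite big_cons Pi.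
by apply: (continuous_cube_ext _ IH) => k _; rewrite big_cons (negbTE Pi).
Qed.

Lemma continuous_cube_prod I (r : seq I) (P : pred I) (F : I -> N.-tuple R -> C) :
  (forall i, P i -> continuous_cube (F i)) ->
  continuous_cube (fun k => \prod_(i <- r | P i) F i k).
Proof.
move=> Fc; elim: r => [|i r IH].
  apply: (@continuous_cube_ext (fun=> 1)) => [k _|]; first by rewrite big_nil.
  exact: continuous_cube_cst.
have [Pi|Pi] := boolP (P i).
  by apply: (continuous_cube_ext _ (continuous_cubeM (Fc i Pi) IH)) => k _; rewrite big_cons Pi.
by apply: (continuous_cube_ext _ IH) => k _; rewrite big_cons (negbTE Pi).
Qed.

End Continuity.

(** * Continuity of matrix-valued functions, entry by entry *)

Section MatrixContinuity.
Context {R : realType} {N : nat}.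
Local Notation C := (Cplx R).
Local Notation mfun p q := (N.-tuple R -> 'M[C]_(p, q)).

Definition continuous_mx p q (F : mfun p q) : Prop :=
  forall a b, continuous_cube (fun k => F k a b).

Lemma continuous_on_cubeP p q (F : mfun p q) : continuous_on_cube F -> continuous_mx F.
Proof.
move=> Fc a b x.
apply: (@continuous_comp (subspace cubeV) 'M[C]_(p, q) C
  (F \o tuple_of_rV) (fun A => A a b)); first exact: Fc.
exact: coord_continuous.
Qed.

Lemma continuous_mx_ext p q (F G : mfun p q) :
  (forall k, cube k -> F k = G k) -> continuous_mx F -> continuous_mx G.
Proof. by move=> FG Fc a b; apply: (continuous_cube_ext _ (Fc a b)) => k kc; rewrite FG. Qed.

Lemma continuous_mx_cst p q (A : 'M[C]_(p, q)) : continuous_mx (fun=> A).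
Proof. by move=> a b; exact: continuous_cube_cst. Qed.

Lemma continuous_mxD p q (F G : mfun p q) : continuous_mx F -> continuous_mx G ->
  continuous_mx (fun k => F k + G k).
Proof.
move=> Fc Gc a b; apply: (continuous_cube_ext _ (continuous_cubeD (Fc a b) (Gc a b))) => k _.
by rewrite mxE.
Qed.

Lemma continuous_mxM p q r (F : mfun p q) (G : mfun q r) :
  continuous_mx F -> continuous_mx G -> continuous_mx (fun k => F k *m G k).
Proof.
move=> Fc Gc a b.
apply: (@continuous_cube_ext _ _ (fun k => \sum_j F k a j * G k j b)) => [k _|].
  by rewrite mxE.
by apply: continuous_cube_sum => j _; exact: continuous_cubeM.
Qed.

Lemma continuous_mxN p q (F : mfun p q) : continuous_mx F -> continuous_mx (fun k => - F k).
Proof.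
move=> Fc a b; apply: (@continuous_cube_ext _ _ (fun k => -1 * F k a b)) => [k _|].
  by rewrite mxE mulN1r.
by apply: continuous_cubeM; [exact: continuous_cube_cst|exact: Fc].
Qed.

Lemma continuous_cube_det n (F : mfun n n) : continuous_mx F ->
  continuous_cube (fun k => \det (F k)).
Proof.
move=> Fc; apply: continuous_cube_sum => s _.
apply: continuous_cubeM; first exact: continuous_cube_cst.
by apply: continuous_cube_prod => i _; exact: Fc.
Qed.

(** By Cramer's formula the entries of the inverse are cofactors divided by the determinant, hence
    polynomials in the entries of [F] over a function without zeros. *)
Lemma continuous_mx_inv n (F : mfun n n) : (forall k, cube k -> \det (F k) != 0) ->
  continuous_mx F -> continuous_mx (fun k => invmx (F k)).
Proof.
move=> F0 Fc a b.
apply: (@continuous_cube_ext _ _ (fun k => (\det (F k))^-1 * cofactor (F k) b a)) => [k kc|].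
  by rewrite /invmx unitmxE unitfE F0// !mxE.
apply: continuous_cubeM; first by apply: continuous_cubeV => //; exact: continuous_cube_det.
apply: continuous_cubeM; first exact: continuous_cube_cst.
apply: continuous_cube_det => i j.
by apply: (continuous_cube_ext _ (Fc (lift b i) (lift a j))) => k _; rewrite !mxE.
Qed.

Lemma continuous_mx_bounded p q (F : mfun p q) : continuous_mx F ->
  exists2 K : R, 0 < K & forall k a b, cube k -> cabs (F k a b) <= K.
Proof.
move=> Fc.
pose h (z : 'I_p * 'I_q) : R := sval (cid2 (continuous_cube_bounded (Fc z.1 z.2))).
have h0 z : 0 < h z by rewrite /h; case: cid2.
have hP z k : cube k -> cabs (F k z.1 z.2) <= h z by rewrite /h; case: cid2 => K ? + ?; exact.
(* The summand 1 keeps the bound positive for a matrix without entries. *)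
exists (1 + \sum_z h z).
  by rewrite ltr_pwDl// sumr_ge0// => z _; exact: ltW.
move=> k a b kc; apply: le_trans (hP (a, b) k kc) _.
rewrite (bigD1 (a, b))//= addrCA lerDl addr_ge0// sumr_ge0// => z _.
exact: ltW.
Qed.

Lemma continuous_mx_unif p q (F : mfun p q) : continuous_mx F -> forall e : R, 0 < e ->
  exists2 d, 0 < d & forall k k', cube k -> cube k' -> dist_lt d k k' ->
    forall a b, cabs (F k a b - F k' a b) < e.
Proof.
move=> Fc e e0.
pose h (z : 'I_p * 'I_q) : R := sval (cid2 (continuous_cube_unif (Fc z.1 z.2) e0)).
have h0 z : 0 < h z by rewrite /h; case: cid2.
have hP z k k' : cube k -> cube k' -> dist_lt (h z) k k' ->
   cabs (F k z.1 z.2 - F k' z.1 z.2) < e.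
  by rewrite /h; case: cid2 => K ? + ? ?; exact.
exists (\big[Num.min/1]_z h z).
  by elim/big_ind: _ => // x y x0 y0; rewrite lt_min x0.
move=> k k' kc k'c kk' a b; apply: (hP (a, b)) => // i.
by apply: lt_le_trans (kk' i) _; exact: bigmin_le.
Qed.

End MatrixContinuity.

(** * Complex integrals over the cube *)

Section ComplexIntegral.
Context {R : realType} {n : nat}.
Local Notation C := (Cplx R).
Local Notation mu := (leb n).
Implicit Types f g : n.-tuple R -> C.

Let mcube : measurable (cube : set (n.-tuple R)).
Proof. exact: measurable_cube. Qed.

Definition cmeas f : Prop :=
  measurable_fun cube (fun k => complex.Re (f k)) /\
  measurable_fun cube (fun k => complex.Im (f k)).

Definition cintegrable f : Prop :=
  mu.-integrable cube (fun k => (complex.Re (f k))%:E) /\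
  mu.-integrable cube (fun k => (complex.Im (f k))%:E).

Lemma cmeas_ext f g : (forall k, cube k -> f k = g k) -> cmeas f -> cmeas g.
Proof.
move=> fg [mR mI]; split; [apply: eq_measurable_fun mR|apply: eq_measurable_fun mI].
all: by move=> k /set_mem kc; rewrite fg.
Qed.

Lemma cmeas_cst (c : C) : cmeas (fun=> c).
Proof. by split; exact: measurable_cst. Qed.

Lemma cmeasD f g : cmeas f -> cmeas g -> cmeas (fun k => f k + g k).
Proof.
move=> [fR fI] [gR gI]; split.
  by under eq_fun do rewrite cReD; exact: measurable_funD.
by under eq_fun do rewrite cImD; exact: measurable_funD.
Qed.

Lemma cmeasM f g : cmeas f -> cmeas g -> cmeas (fun k => f k * g k).
Proof.
move=> [fR fI] [gR gI]; split.
  under eq_fun do rewrite cReM.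
  by apply: measurable_funB; exact: measurable_funM.
under eq_fun do rewrite cImM.
by apply: measurable_funD; exact: measurable_funM.
Qed.

Lemma cmeas_sum I (r : seq I) (F : I -> n.-tuple R -> C) :
  (forall i, cmeas (F i)) -> cmeas (fun k => \sum_(i <- r) F i k).
Proof.
move=> Fm; elim: r => [|i r IH].
  by apply: (@cmeas_ext (fun=> 0)) => [k _|]; [rewrite big_nil|exact: cmeas_cst].
by apply: (cmeas_ext _ (cmeasD (Fm i) IH)) => k _; rewrite big_cons.
Qed.

Lemma measurable_cabs_sqr f : cmeas f ->
  measurable_fun cube (fun k => cabs (f k) ^+ 2).
Proof.
move=> [fR fI]; under eq_fun do rewrite cabs_sqr.
by apply: measurable_funD; exact: measurable_funX.
Qed.

Lemma cintegrable_cmeas f : cintegrable f -> cmeas f.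
Proof.
by move=> [/measurable_int/measurable_EFinP ? /measurable_int/measurable_EFinP].
Qed.

Lemma cintegrable_ext f g :
  (forall k, cube k -> f k = g k) -> cintegrable f -> cintegrable g.
Proof.
move=> fg [fR fI]; split; [apply: eq_integrable fR|apply: eq_integrable fI] => //.
all: by move=> k /set_mem kc; rewrite fg.
Qed.

Lemma cintegrableD f g :
  cintegrable f -> cintegrable g -> cintegrable (fun k => f k + g k).
Proof.
move=> [fR fI] [gR gI]; split.
  by under eq_fun do rewrite cReD EFinD; exact: integrableD.
by under eq_fun do rewrite cImD EFinD; exact: integrableD.
Qed.

Lemma cintegrableZ (c : C) f : cintegrable f -> cintegrable (fun k => c * f k).
Proof.
move=> [fR fI]; split.
  under eq_fun do rewrite cReM EFinB !EFinM.
  by apply: integrableB => //; exact: integrableZl.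
under eq_fun do rewrite cImM EFinD !EFinM.
by apply: integrableD => //; exact: integrableZl.
Qed.

Lemma cintegrable_sum I (r : seq I) (F : I -> n.-tuple R -> C) :
  (forall i, cintegrable (F i)) -> cintegrable (fun k => \sum_(i <- r) F i k).
Proof.
move=> Fm; elim: r => [|i r IH].
  apply: (@cintegrable_ext (fun=> 0)) => [k _|]; first by rewrite big_nil.
  by split; exact: integrable0.
by apply: (cintegrable_ext _ (cintegrableD (Fm i) IH)) => k _; rewrite big_cons.
Qed.

Lemma cintegrable_bounded f (K : R) : cmeas f ->
  (forall k, cube k -> cabs (f k) <= K) -> cintegrable f.
Proof.
move=> [fR fI] fK; split; apply: measurable_bounded_integrable => //.
1,3: by rewrite [X in (X < _)%E]leb_cube ltry.
all: exists K; split; first exact: num_real.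
all: move=> x Kx k kc /=; apply: le_trans (ltW Kx); apply: le_trans (fK k kc).
  exact: ler_Re_cabs.
exact: ler_Im_cabs.
Qed.

(** The cube has finite measure, so 1 + |f|^2 is integrable, and it dominates |f|. *)
Lemma cintegrable_sqr f : cmeas f ->
  (\int[mu]_(k in cube) (cabs (f k) ^+ 2)%:E < +oo)%E -> cintegrable f.
Proof.
move=> fm foo; have [fR fI] := fm.
have i1 : mu.-integrable cube (fun k => (1 + cabs (f k) ^+ 2)%:E).
  under eq_fun do rewrite EFinD.
  apply: integrableD => //.
    apply/integrableP; split; first exact: measurable_cst.
    rewrite integral_cst// [X in (_ * X < _)%E]leb_cube mule1.
    by rewrite ltry.
  apply/integrableP; split; first by apply/measurable_EFinP; exact: measurable_cabs_sqr.
  under eq_integral do rewrite gee0_abs ?lee_fin ?sqr_ge0//.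
  exact: foo.
have le1 (x y : R) : `|x| <= y -> `|x| <= `|1 + y ^+ 2|.
  by move=> xy; rewrite (@le_trans _ _ (1 + y ^+ 2)) ?ler_norm//; nra.
split; apply: le_integrable i1 => //; try exact/measurable_EFinP.
all: move=> k kc; rewrite !abse_EFin lee_fin; apply: le1.
  exact: ler_Re_cabs.
exact: ler_Im_cabs.
Qed.

Lemma cube_integral_ext f g : (forall k, cube k -> f k = g k) ->
  cube_integral f = cube_integral g.
Proof.
move=> fg; rewrite /cube_integral; congr Complex.
all: by apply: eq_Rintegral => k /set_mem kc; rewrite fg.
Qed.

Lemma cube_integralD f g : cintegrable f -> cintegrable g ->
  cube_integral (fun k => f k + g k) = cube_integral f + cube_integral g.
Proof.
move=> [fR fI] [gR gI]; rewrite /cube_integral.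
under eq_Rintegral do rewrite cReD.
under [X in Complex _ X]eq_Rintegral do rewrite cImD.
by rewrite !RintegralD.
Qed.

Lemma cube_integralZ (c : C) f : cintegrable f ->
  cube_integral (fun k => c * f k) = c * cube_integral f.
Proof.
move=> [fR fI]; rewrite /cube_integral.
under eq_Rintegral do rewrite cReM.
under [X in Complex _ X]eq_Rintegral do rewrite cImM.
have iZ (a : R) (h : n.-tuple R -> R) : mu.-integrable cube (EFin \o h) ->
    mu.-integrable cube (EFin \o (fun k => a * h k)).
  by move=> ih; rewrite /comp; under eq_fun do rewrite EFinM; exact: integrableZl.
rewrite RintegralB//; try exact: iZ.
rewrite RintegralD//; try exact: iZ.
by rewrite !RintegralZl//; case: (c).
Qed.

Lemma cube_integral_sum I (r : seq I) (F : I -> n.-tuple R -> C) :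
  (forall i, cintegrable (F i)) ->
  cube_integral (fun k => \sum_(i <- r) F i k) =
  \sum_(i <- r) cube_integral (F i).
Proof.
move=> Fi; elim: r => [|i r IH].
  rewrite big_nil (@cube_integral_ext _ (fun=> 0)); last by move=> k _; rewrite big_nil.
  by rewrite /cube_integral /= !Rintegral_cst// !mul0r.
rewrite big_cons -IH -cube_integralD//; last exact: cintegrable_sum.
by apply: cube_integral_ext => k _; rewrite big_cons.
Qed.

Lemma Rintegral_bound (h g : n.-tuple R -> R) :
  mu.-integrable cube (EFin \o h) -> mu.-integrable cube (EFin \o g) ->
  (forall k, cube k -> `|h k| <= g k) ->
  `|\int[mu]_(k in cube) h k| <= \int[mu]_(k in cube) g k.
Proof.
move=> ih ig hg; apply: le_trans (le_normr_Rintegral _ ih) _ => //.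
by apply: le_Rintegral => //; exact: integrable_norm.
Qed.

(** Real and imaginary parts are bounded separately, whence the factor 2. *)
Lemma cabs_cube_integral_le f (g : n.-tuple R -> R) : cintegrable f ->
  mu.-integrable cube (EFin \o g) -> (forall k, cube k -> cabs (f k) <= g k) ->
  cabs (cube_integral f) <= 2 * \int[mu]_(k in cube) g k.
Proof.
move=> [fR fI] ig fg; apply: le_trans (cabs_le_ReIm _) _.
rewrite mulr_natl mulr2n lerD//=; apply: Rintegral_bound => // k kc.
all: apply: le_trans (fg k kc); by [exact: ler_Re_cabs|exact: ler_Im_cabs].
Qed.

Lemma cabs_cube_integral_le_cst f (K : R) : cintegrable f ->
  (forall k, cube k -> cabs (f k) <= K) -> cabs (cube_integral f) <= 2 * K.
Proof.
move=> fi fK; apply: le_trans (cabs_cube_integral_le (g := fun=> K) fi _ fK) _.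
  have [] := @cintegrable_bounded (fun=> K%:C%C) `|K| (cmeas_cst _) => //.
  by move=> k _; rewrite -lecR cabsE normc_def /= expr0n /= addr0 sqrtr_sqr.
by rewrite Rintegral_cst// [X in fine X](leb_cube n) mulr1.
Qed.

(** The variance, the integral of (h - m)^2 with [m] the mean, is nonnegative; expanding it uses
    that the cube has mass 1. *)
Lemma Rintegral_sqr_le (h : n.-tuple R -> R) :
  mu.-integrable cube (EFin \o h) ->
  mu.-integrable cube (EFin \o (fun k => h k ^+ 2)) ->
  (\int[mu]_(k in cube) h k) ^+ 2 <= \int[mu]_(k in cube) (h k ^+ 2).
Proof.
move=> ih ih2; set m := \int[mu]_(k in cube) h k.
have ic (c : R) : mu.-integrable cube (EFin \o cst c).
  apply: measurable_bounded_integrable => //.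
  - by rewrite [X in (X < _)%E]leb_cube ltry.
  - exact: bounded_cst.
have iZ : mu.-integrable cube (EFin \o (fun k => (2 * m) * h k)).
  by rewrite /comp; under eq_fun do rewrite EFinM; exact: integrableZl.
have le_sq (x y : R) : 0 <= x - 2 * y * y + y ^+ 2 * 1 -> y ^+ 2 <= x by nra.
have : 0 <= \int[mu]_(k in cube) (h k - m) ^+ 2.
  by apply: Rintegral_ge0 => k _; exact: sqr_ge0.
rewrite (@eq_Rintegral _ _ _ _ _ (fun k => (h k ^+ 2 - (2 * m) * h k) + m ^+ 2)).
  have iB : mu.-integrable cube (EFin \o (fun k => h k ^+ 2 - (2 * m) * h k)).
    by rewrite /comp; under eq_fun do rewrite EFinB; exact: integrableB.
  rewrite (RintegralD mcube iB (ic (m ^+ 2))).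
  rewrite RintegralB// RintegralZl// Rintegral_cst// -/m [X in fine X](leb_cube n) /=.
  exact: le_sq.
by move=> k _; ring.
Qed.

(** Squares of real and imaginary parts add up exactly, so no constant is lost here and averaging
    becomes a contraction. *)
Lemma cabs_cube_integral_sqr_le f : cintegrable f ->
  ((cabs (cube_integral f) ^+ 2)%:E <=
   \int[mu]_(k in cube) (cabs (f k) ^+ 2)%:E)%E.
Proof.
move=> fi; have fm := cintegrable_cmeas fi.
have c0 k : (0 <= (cabs (f k) ^+ 2)%:E)%E by rewrite lee_fin sqr_ge0.
have [foo|] := ltP (\int[mu]_(k in cube) (cabs (f k) ^+ 2)%:E)%E +oo%E; last first.
  by rewrite leye_eq => /eqP ->; rewrite leey.
have [fR fI] := fi; have [mR mI] := fm.
have i2 : mu.-integrable cube (EFin \o (fun k => cabs (f k) ^+ 2)).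
  apply/integrableP; split; first by apply/measurable_EFinP; exact: measurable_cabs_sqr.
  by under eq_integral do rewrite gee0_abs//=.
have le2 (h : n.-tuple R -> R) : measurable_fun cube h ->
    (forall k, `|h k| <= cabs (f k)) ->
    mu.-integrable cube (EFin \o (fun k => h k ^+ 2)).
  move=> mh hf; apply: le_integrable i2 => //.
    by apply/measurable_EFinP; exact: measurable_funX.
  move=> k kc; rewrite /= lee_fin !ger0_norm ?sqr_ge0//.
  by rewrite -real_normK ?num_real// ler_pXn2r ?nnegrE ?cabs_ge0.
have iR := le2 _ mR (fun k => ler_Re_cabs (f k)).
have iI := le2 _ mI (fun k => ler_Im_cabs (f k)).
have -> : (\int[mu]_(k in cube) (cabs (f k) ^+ 2)%:E =
    (\int[mu]_(k in cube) (cabs (f k) ^+ 2))%:E)%E.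
  by rewrite /Rintegral fineK//; exact: integrable_fin_num.
rewrite lee_fin cabs_sqr /=.
under [leRHS]eq_Rintegral do rewrite cabs_sqr.
by rewrite RintegralD// lerD// Rintegral_sqr_le.
Qed.

End ComplexIntegral.

(** * Averages over the first variables *)

Section Grid.
Context {R : realType} {N : nat}.
Local Notation C := (Cplx R).

(** Continuity lives on row vectors and measurability on tuples. A continuous function is shown to
    be measurable as the pointwise limit of its samples on the grid of mesh 1/(m+1); rounding down
    keeps the sample points in the cube. *)
Definition grid_tuple (m : nat) (z : N.-tuple int) : N.-tuple R :=
  [tuple (tnth z i)%:~R / m.+1%:R | i < N].

Definition grid_floor (m : nat) (k : N.-tuple R) : N.-tuple int :=
  [tuple Num.floor (m.+1%:R * tnth k i) | i < N].

Lemma cube_grid m k : cube k -> cube (grid_tuple m (grid_floor m k)).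
Proof.
move=> kc i; rewrite !tnth_mktuple; have /andP[k0 k1] := kc i.
rewrite divr_ge0//= ?ler0z ?floor_ge0 ?mulr_ge0//.
rewrite ler_pdivrMr ?ltr0n// mul1r (le_trans (floor_le _))//.
by rewrite ger_pMr ?ltr0n.
Qed.

Lemma dist_grid m k d : m.+1%:R^-1 < d ->
  dist_lt d k (grid_tuple m (grid_floor m k)).
Proof.
move=> md i; rewrite !tnth_mktuple; set x := tnth k i.
apply: le_lt_trans md.
have m0 : 0 < m.+1%:R :> R by rewrite ltr0n.
rewrite -(ler_pM2l m0) divff ?gt_eqF// -{1}(gtr0_norm m0) -normrM mulrBr.
rewrite mulrCA divff ?gt_eqF// mulr1.
have /andP[f1 f2] := floor_itv (m.+1%:R * x).
rewrite ger0_norm ?subr_ge0// lerBlDr addrC ltW//.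
by rewrite -[X in _ + X]/(1%:~R) -intrD.
Qed.

(** The sampled function is constant on each half-open grid box, and integer tuples are countable,
    so every preimage is a countable union of boxes. *)
Lemma measurable_grid m (g : N.-tuple R -> R) :
  measurable_fun setT (fun k => g (grid_tuple m (grid_floor m k))).
Proof.
move=> _ Y mY; rewrite setTI.
rewrite (_ : _ @^-1` _ = \bigcup_(z : N.-tuple int)
    (if `[< Y (g (grid_tuple m z)) >] then
      box (fun i => `[(tnth z i)%:~R / m.+1%:R, (tnth z i + 1)%:~R / m.+1%:R[%classic)
     else set0)).
  apply: countable_bigcupT_measurable => [|z]; first exact: countableP.
  by case: ifP => // _; apply: measurable_box => i; exact: measurable_itv.
have m0 : 0 < m.+1%:R :> R by rewrite ltr0n.
have itvE (x : R) (z : int) :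
    (z%:~R / m.+1%:R <= x < (z + 1)%:~R / m.+1%:R) = (Num.floor (m.+1%:R * x) == z).
  by rewrite floor_eq ler_pdivrMr// ltr_pdivlMr// ![x * _]mulrC.
apply/seteqP; split => [k /= Yk|k [z _]].
  exists (grid_floor m k) => //; rewrite asboolT// => i /=.
  by rewrite in_itv /= itvE tnth_mktuple.
case: ifPn => // /asboolP Yz kz /=; rewrite (_ : grid_floor m k = z)//.
apply: eq_from_tnth => i; rewrite tnth_mktuple; apply/eqP.
by rewrite -itvE; have := kz i; rewrite /= in_itv.
Qed.

Lemma continuous_cube_cmeas (f : N.-tuple R -> C) : continuous_cube f -> cmeas f.
Proof.
move=> fc.
(* Real and imaginary part are handled together, as functions that are 1-Lipschitz for [cabs]. *)
have H (h : C -> R) : (forall z w, `|h z - h w| <= cabs (z - w)) ->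
    measurable_fun cube (h \o f).
  move=> hl; apply: (@measurable_fun_cvg _ _ _ cube
    (fun m k => h (f (grid_tuple m (grid_floor m k))))).
    by move=> m; apply: measurable_funTS; exact: (measurable_grid m (h \o f)).
  move=> k kc; apply/cvgrPdist_lt => e e0.
  have [d d0 dP] := continuous_cube_unif fc e0.
  near=> m; apply: le_lt_trans (hl _ _) _; apply: dP => //.
    exact: cube_grid.
  apply: dist_grid; near: m; exact: (near_infty_natSinv_lt (PosNum d0)).
split.
  by apply: (H) => -[a b] [c d]; exact: (ler_Re_cabs (Complex a b - Complex c d)).
by apply: (H) => -[a b] [c d]; exact: (ler_Im_cabs (Complex a b - Complex c d)).
Unshelve. all: by end_near. Qed.

End Grid.

(** * Measurability and continuity of slice integrals *)

Section PrefixIntegral.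
Context {R : realType} {N j : nat}.
Local Notation C := (Cplx R).
Implicit Types f : N.-tuple R -> C.

(** Slices may fail to be integrable. The extended integral is the difference of the integrals of
    the positive and negative parts, each measurable in [k] by Tonelli, and [fine] is measurable. *)
Lemma measurable_prefix_Rintegral (h : N.-tuple R -> R) : measurable_fun cube h ->
  measurable_fun cube
    (fun k => \int[leb j]_(t in cube) h (set_prefix t k)).
Proof.
move=> mh; have mC := @measurable_cube R N; have mCj := @measurable_cube R j.
have mE : measurable_fun cube (EFin \o h) by exact/measurable_EFinP.
apply: (@measurableT_comp _ _ _ _ _ _ fine) => //.
under eq_fun do rewrite integralE.
have mP := @measurable_prefix_integral R j N ((EFin \o h)^\+)%E
  (measurable_funepos mE) (fun k _ => funepos_ge0 _ k).
have mQ := @measurable_prefix_integral R j N ((EFin \o h)^\-)%E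
  (measurable_funeneg mE) (fun k _ => funeneg_ge0 _ k).
apply: emeasurable_funB.
  rewrite (_ : (fun k => _) = (fun k =>
    \int[leb j]_(t in cube) ((EFin \o h)^\+ (set_prefix t k))%E)%E)//.
  by apply/funext => k; apply: eq_integral => t _; rewrite !funeposE.
rewrite (_ : (fun k => _) = (fun k =>
  \int[leb j]_(t in cube) ((EFin \o h)^\- (set_prefix t k))%E)%E)//.
by apply/funext => k; apply: eq_integral => t _; rewrite !funenegE.
Qed.

Lemma cmeas_prefix_integral f : cmeas f ->
  cmeas (fun k => cube_integral (fun t : j.-tuple R => f (set_prefix t k))).
Proof.
move=> [mR mI].
by split; [exact: (measurable_prefix_Rintegral mR)|
           exact: (measurable_prefix_Rintegral mI)].
Qed.

Lemma cmeas_slice f k : cube k -> cmeas f ->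
  cmeas (fun t : j.-tuple R => f (set_prefix t k)).
Proof.
move=> kc [mR mI].
by split; [exact: (measurable_fun_set_prefix kc mR)|
           exact: (measurable_fun_set_prefix kc mI)].
Qed.

Lemma continuous_cube_slice_integrable f k : cube k -> continuous_cube f ->
  cintegrable (fun t : j.-tuple R => f (set_prefix t k)).
Proof.
move=> kc fc; have [K K0 fK] := continuous_cube_bounded fc.
apply: (cintegrable_bounded (cmeas_slice kc (continuous_cube_cmeas fc)) (K := K)) => t tc.
by apply: fK; exact: cube_set_prefix.
Qed.

Lemma dist_set_prefix d (t : j.-tuple R) (k k' : N.-tuple R) : 0 < d ->
  dist_lt d k k' -> dist_lt d (set_prefix t k) (set_prefix t k').
Proof.
move=> d0 kk' i; rewrite !tnth_set_prefix.
have [ij|ij] := ltnP i j; last by rewrite !nth_default ?size_tuple.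
by rewrite -!(tnth_nth _ t (Ordinal ij)) subrr normr0.
Qed.

Lemma continuous_cube_prefix_integral f : continuous_cube f ->
  continuous_cube (fun k => cube_integral (fun t : j.-tuple R => f (set_prefix t k))).
Proof.
move=> fc; apply/continuous_cubeP => k kc e e0.
(* The factor 2 in [cabs_cube_integral_le_cst] turns this into e/2, strictly below [e]. *)
have e40 : 0 < e / 4 by rewrite divr_gt0.
have [d d0 dP] := continuous_cube_unif fc e40.
exists d => // k' k'c kk'.
have ik := continuous_cube_slice_integrable kc fc.
have ik' := continuous_cube_slice_integrable k'c fc.
rewrite -mulN1r -cube_integralZ// -cube_integralD//; last exact: cintegrableZ.
apply: (@le_lt_trans _ _ (2 * (e / 4))); last by lra.
apply: cabs_cube_integral_le_cst => [|t tc].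
  by apply: cintegrableD => //; exact: cintegrableZ.
rewrite mulN1r ltW//; apply: dP; try exact: cube_set_prefix.
exact: dist_set_prefix.
Qed.

End PrefixIntegral.

(** A longer prefix overwrites a shorter one; hence an average over [i] variables is constant along
    slices in the first [j <= i]. *)
Lemma set_prefix_absorb (R : realType) (N i j : nat) (s : i.-tuple R)
    (t : j.-tuple R) (k : N.-tuple R) : (j <= i)%N ->
  set_prefix s (set_prefix t k) = set_prefix s k.
Proof.
move=> ji; apply: eq_from_tnth => l; rewrite !tnth_set_prefix.
have [li|il] := ltnP l i; first by rewrite -!(tnth_nth _ s (Ordinal li)).
by rewrite !nth_default ?size_tuple// (leq_trans ji).
Qed.

Section Average.
Context {R : realType} {N : nat}.
Local Notation C := (Cplx R).
Local Notation mfun p q := (N.-tuple R -> 'M[C]_(p, q)).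

(** A condition at a single point [k]: it is what linearity of the average at [k] requires.
    Continuous functions satisfy it at every point of the cube, square integrable ones at almost
    every point ([ae_slice_integrable]). *)
Definition slice_integrable p q j (F : mfun p q) (k : N.-tuple R) : Prop :=
  forall a b, cintegrable (fun t : j.-tuple R => F (set_prefix t k) a b).

Definition slice_constant p q j (w : mfun p q) (k : N.-tuple R) : Prop :=
  forall t : j.-tuple R, cube t -> w (set_prefix t k) = w k.

Lemma avg_slice_constant p q i j (F : mfun p q) k : (j <= i)%N ->
  slice_constant j (avg i F) k.
Proof.
move=> ji t _; apply/matrixP => a b; rewrite !mxE.
by apply: cube_integral_ext => s _; rewrite set_prefix_absorb.
Qed.

Lemma avg_ext p q j (F G : mfun p q) k :
  (forall t : j.-tuple R, cube t -> F (set_prefix t k) = G (set_prefix t k)) ->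
  avg j F k = avg j G k.
Proof.
move=> FG; apply/matrixP => a b; rewrite !mxE.
by apply: cube_integral_ext => t tc; rewrite FG.
Qed.

Lemma continuous_mx_avg p q j (F : mfun p q) : continuous_mx F -> continuous_mx (avg j F).
Proof.
move=> Fc a b.
apply: (@continuous_cube_ext _ _
  (fun k => cube_integral (fun t : j.-tuple R => F (set_prefix t k) a b))).
  by move=> k _; rewrite mxE.
exact: (continuous_cube_prefix_integral (Fc a b)).
Qed.

Lemma continuous_mx_slice_integrable p q j (F : mfun p q) k : cube k -> continuous_mx F ->
  slice_integrable j F k.
Proof. by move=> kc Fc a b; exact: (continuous_cube_slice_integrable kc (Fc a b)). Qed.

Lemma slice_integrableD p q j (F G : mfun p q) k :
  slice_integrable j F k -> slice_integrable j G k ->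
  slice_integrable j (fun k => F k + G k) k.
Proof.
move=> iF iG a b; apply: cintegrable_ext (cintegrableD (iF a b) (iG a b)) => t _.
by rewrite mxE.
Qed.

Lemma avgD p q j (F G : mfun p q) k :
  slice_integrable j F k -> slice_integrable j G k ->
  avg j (fun k => F k + G k) k = avg j F k + avg j G k.
Proof.
move=> iF iG; apply/matrixP => a b; rewrite !mxE -cube_integralD//.
by apply: cube_integral_ext => t _; rewrite mxE.
Qed.

Lemma avgZ p q j (c : C) (F : mfun p q) k : slice_integrable j F k ->
  avg j (fun k => c *: F k) k = c *: avg j F k.
Proof.
move=> iF; apply/matrixP => a b; rewrite !mxE -cube_integralZ//.
by apply: cube_integral_ext => t _; rewrite mxE.
Qed.

Lemma slice_integrableZ p q j (c : C) (F : mfun p q) k :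
  slice_integrable j F k -> slice_integrable j (fun k => c *: F k) k.
Proof.
move=> iF a b; apply: cintegrable_ext (cintegrableZ c (iF a b)) => t _.
by rewrite mxE.
Qed.

Lemma slice_integrableMr p q r j (F : mfun p q) (w : mfun q r) k :
  slice_integrable j F k -> slice_constant j w k ->
  slice_integrable j (fun k => F k *m w k) k.
Proof.
move=> iF wk a b.
apply: (@cintegrable_ext _ _
    (fun t => \sum_l w k l b * F (set_prefix t k) a l)).
  by move=> t tc; rewrite mxE wk//; apply: eq_bigr => l _; rewrite mulrC.
by apply: cintegrable_sum => l; exact: cintegrableZ.
Qed.

Lemma avgMr p q r j (F : mfun p q) (w : mfun q r) k :
  slice_integrable j F k -> slice_constant j w k ->
  avg j (fun k => F k *m w k) k = avg j F k *m w k.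
Proof.
move=> iF wk; apply/matrixP => a b; rewrite !mxE.
transitivity (cube_integral (fun t : j.-tuple R =>
    \sum_l w k l b * F (set_prefix t k) a l)).
  apply: cube_integral_ext => t tc; rewrite mxE wk//.
  by apply: eq_bigr => l _; rewrite mulrC.
rewrite cube_integral_sum; last by move=> l; exact: cintegrableZ.
by apply: eq_bigr => l _; rewrite cube_integralZ// mulrC mxE.
Qed.

Lemma cintegrableMl n (f g : n.-tuple R -> C) (K : R) : cmeas f ->
  (forall t, cube t -> cabs (f t) <= K) -> cintegrable g ->
  cintegrable (fun t => f t * g t).
Proof.
move=> [fR fI] fK [gR gI].
have mC := @measurable_cube R n.
have M (h : C -> R) (g' : n.-tuple R -> R) : (forall z, `|h z| <= cabs z) ->
    measurable_fun cube (h \o f) -> (leb n).-integrable cube (EFin \o g') ->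
    (leb n).-integrable cube (EFin \o (fun t => h (f t) * g' t)).
  move=> hle mh ig'; apply: (integrableMr mC mh _ ig').
  exists K; split; first exact: num_real.
  move=> x Kx t tc /=; apply: le_trans (ltW Kx); apply: le_trans (fK t tc).
  exact: hle.
have reP := M _ _ ler_Re_cabs fR; have imP := M _ _ ler_Im_cabs fI.
split.
  under eq_fun do rewrite cReM EFinB.
  by apply: integrableB => //; [exact: (reP _ gR)|exact: (imP _ gI)].
under eq_fun do rewrite cImM EFinD.
by apply: integrableD => //; [exact: (reP _ gI)|exact: (imP _ gR)].
Qed.

Lemma slice_integrableMl p q r j (B : mfun p q) (F : mfun q r) k : cube k ->
  continuous_mx B -> slice_integrable j F k -> slice_integrable j (fun k => B k *m F k) k.
Proof.
move=> kc Bc iF a b.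
apply: (@cintegrable_ext _ _
    (fun t => \sum_l B (set_prefix t k) a l * F (set_prefix t k) l b)).
  by move=> t tc; rewrite mxE.
apply: cintegrable_sum => l; have [K _ BK] := continuous_cube_bounded (Bc a l).
apply: (cintegrableMl (K := K)) => //.
  exact: (cmeas_slice kc (continuous_cube_cmeas (Bc a l))).
by move=> t tc; apply: BK; exact: cube_set_prefix.
Qed.

End Average.

(** * The squared L2 norm *)

Section SquaredNorm.
Context {R : realType}.
Local Notation C := (Cplx R).

Definition sqnorm p (x : 'cV[C]_p) : R := \sum_(i < p) cabs (x i 0) ^+ 2.

Lemma sqnorm_ge0 p (x : 'cV[C]_p) : 0 <= sqnorm x.
Proof. by apply: sumr_ge0 => i _; exact: sqr_ge0. Qed.

Lemma cV_norm_sqr p (x : 'cV[C]_p) : cV_norm x ^+ 2 = sqnorm x.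
Proof.
rewrite /cV_norm sqr_sqrtr.
  by apply: eq_bigr => i _; rewrite cabs_sqr.
by apply: sumr_ge0 => i _; rewrite addr_ge0 ?sqr_ge0.
Qed.

Lemma sqnorm_eq0 p (x : 'cV[C]_p) : (sqnorm x == 0) = (x == 0).
Proof.
apply/eqP/eqP => [x0|->]; last first.
  by rewrite /sqnorm big1// => i _; rewrite mxE cabs0 expr0n.
apply/matrixP => i j; rewrite (ord1 j) mxE; apply/eqP; rewrite -cabs_eq0.
have /psumr_eq0P := x0 => /(_ (fun i _ => sqr_ge0 _)) /(_ i isT) /eqP.
by rewrite sqrf_eq0.
Qed.

Lemma cabs_le_sqnorm p (x : 'cV[C]_p) i : cabs (x i 0) ^+ 2 <= sqnorm x.
Proof.
by rewrite /sqnorm (bigD1 i)//= lerDl sumr_ge0// => l _; exact: sqr_ge0.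
Qed.

(** The substitute for the triangle inequality after squaring, and the source of the factors 2 in
    later constants. *)
Lemma sqnormD p (x y : 'cV[C]_p) : sqnorm (x + y) <= 2 * sqnorm x + 2 * sqnorm y.
Proof.
rewrite /sqnorm !mulr_sumr -big_split; apply: ler_sum => i _ /=; rewrite mxE.
have := cabsD (x i 0) (y i 0); have := cabs_ge0 (x i 0 + y i 0).
set a := cabs (x i 0); set b := cabs (y i 0); set c := cabs _.
by move=> c0 cab; have := sqr_ge0 (a - b); nra.
Qed.

Lemma sqnormZ p (c : C) (x : 'cV[C]_p) : sqnorm (c *: x) = cabs c ^+ 2 * sqnorm x.
Proof.
by rewrite /sqnorm mulr_sumr; apply: eq_bigr => i _; rewrite mxE cabsM exprMn.
Qed.

(** Each of the [p] entries of the product is at most q K times the norm of [x]. *)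
Lemma sqnorm_mulmx p q (A : 'M[C]_(p, q)) (x : 'cV[C]_q) (K : R) : 0 <= K ->
  (forall a b, cabs (A a b) <= K) ->
  sqnorm (A *m x) <= p%:R * (q%:R * K) ^+ 2 * sqnorm x.
Proof.
move=> K0 AK; set s := Num.sqrt (sqnorm x).
have s2 : s ^+ 2 = sqnorm x by rewrite sqr_sqrtr ?sqnorm_ge0.
have xs i : cabs (x i 0) <= s.
  by rewrite -(@ler_pXn2r _ 2)// ?nnegrE ?cabs_ge0 ?sqrtr_ge0// s2 cabs_le_sqnorm.
rewrite -s2 -mulrA -exprMn -[p in p%:R]card_ord -sum1_card natr_sum mulr_suml.
apply: ler_sum => a _; rewrite mul1r ler_pXn2r ?nnegrE ?cabs_ge0//; last first.
  by rewrite !mulr_ge0// sqrtr_ge0.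
have cabs_sum (r : seq 'I_q) (F : 'I_q -> C) :
    cabs (\sum_(i <- r) F i) <= \sum_(i <- r) cabs (F i).
  elim/big_rec2: _ => [|i y z _ yz]; first by rewrite cabs0.
  by apply: le_trans (cabsD _ _) _; rewrite lerD2l.
rewrite mxE; apply: le_trans (cabs_sum _ _) _.
rewrite -mulrA -[q in q%:R]card_ord -sum1_card natr_sum mulr_suml.
by apply: ler_sum => b _; rewrite mul1r cabsM ler_pM ?cabs_ge0.
Qed.

End SquaredNorm.

Section Energy.
Context {R : realType} {N : nat}.
Local Notation C := (Cplx R).
Local Notation vfun p := (N.-tuple R -> 'cV[C]_p).
Local Notation mfun p q := (N.-tuple R -> 'M[C]_(p, q)).
Local Open Scope ereal_scope.

Let mC : measurable (cube : set (N.-tuple R)). Proof. exact: measurable_cube. Qed.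

Definition vmeas p (u : vfun p) : Prop := forall i, cmeas (fun k => u k i ord0).

(** Squares keep roots out of the estimates, and infinite values let these be stated for all
    measurable functions; [L2E] and [L2norm_le] translate back to the norm. *)
Definition energy p (u : vfun p) : \bar R := \int[leb N]_(k in cube) (sqnorm (u k))%:E.

Lemma energy_ge0 p (u : vfun p) : 0 <= energy u.
Proof. by apply: integral_ge0 => k _; rewrite lee_fin sqnorm_ge0. Qed.

Lemma measurable_sqnorm p (u : vfun p) : vmeas u ->
  measurable_fun cube (fun k => sqnorm (u k)).
Proof.
by move=> um; apply: measurable_sum => i; exact: measurable_cabs_sqr.
Qed.

Lemma emeasurable_sqnorm p (u : vfun p) : vmeas u ->
  measurable_fun cube (fun k => (sqnorm (u k))%:E).
Proof. by move=> um; apply/measurable_EFinP; exact: measurable_sqnorm. Qed.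

Lemma vmeasD p (u v : vfun p) : vmeas u -> vmeas v ->
  vmeas (fun k => (u k + v k)%R).
Proof.
move=> um vm i; apply: cmeas_ext (cmeasD (um i) (vm i)) => k _.
by rewrite mxE.
Qed.

Lemma vmeasZ p (c : C) (u : vfun p) : vmeas u -> vmeas (fun k => c *: u k).
Proof.
move=> um i; apply: cmeas_ext (cmeasM (cmeas_cst c) (um i)) => k _.
by rewrite mxE.
Qed.

Lemma vmeas_mulmx p q (F : mfun p q) (u : vfun q) :
  (forall a b, cmeas (fun k => F k a b)) ->
  vmeas u -> vmeas (fun k => F k *m u k).
Proof.
move=> Fm um i.
apply: (@cmeas_ext _ _ (fun k => \sum_l F k i l * u k l ord0)%R).
  by move=> k _; rewrite mxE.
by apply: cmeas_sum => l; exact: cmeasM.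
Qed.

Lemma vmeas_avg p j (u : vfun p) : vmeas u -> vmeas (avg j u).
Proof.
move=> um i; apply: cmeas_ext (cmeas_prefix_integral (j := j) (um i)) => k _.
by rewrite mxE.
Qed.

Lemma energy_le p q (u : vfun p) (v : vfun q) (c : R) : (0 <= c)%R ->
  vmeas u -> vmeas v -> (forall k, cube k -> (sqnorm (u k) <= c * sqnorm (v k))%R) ->
  energy u <= c%:E * energy v.
Proof.
move=> c0 um vm uv; rewrite /energy -ge0_integralZl_EFin//; last 2 first.
- by move=> k _; rewrite lee_fin sqnorm_ge0.
- exact: emeasurable_sqnorm.
apply: ge0_le_integral => //.
- by move=> k _; rewrite lee_fin sqnorm_ge0.
- exact: emeasurable_sqnorm.
- by apply: measurable_funeM; exact: emeasurable_sqnorm.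
Qed.

Lemma energy_D p (u v : vfun p) : vmeas u -> vmeas v ->
  energy (fun k => (u k + v k)%R) <= 2%:E * energy u + 2%:E * energy v.
Proof.
move=> um vm; rewrite /energy -!ge0_integralZl_EFin//; first last.
1,3: exact: emeasurable_sqnorm.
1,2: by move=> k _; rewrite lee_fin sqnorm_ge0.
have mu2 (w : vfun p) : vmeas w ->
    measurable_fun cube (fun k => 2%:E * (sqnorm (w k))%:E).
  by move=> wm; apply: measurable_funeM; exact: emeasurable_sqnorm.
have ge2 (w : vfun p) k : 0 <= 2%:E * (sqnorm (w k))%:E.
  by rewrite -EFinM lee_fin mulr_ge0// sqnorm_ge0.
rewrite -ge0_integralD//; try exact: mu2.
apply: ge0_le_integral => //.
- by move=> k _; rewrite lee_fin sqnorm_ge0.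
- by apply: emeasurable_sqnorm; exact: vmeasD.
- by apply: emeasurable_funD; exact: mu2.
- by move=> k _; rewrite -!EFinM -EFinD lee_fin sqnormD.
Qed.

Lemma energy_Z p (c : C) (u : vfun p) : vmeas u ->
  energy (fun k => c *: u k) = (cabs c ^+ 2)%:E * energy u.
Proof.
move=> um; rewrite /energy -ge0_integralZl_EFin ?sqr_ge0//; last 2 first.
- by move=> k _; rewrite lee_fin sqnorm_ge0.
- exact: emeasurable_sqnorm.
by apply: eq_integral => k _; rewrite sqnormZ EFinM.
Qed.

(* On a slice that is not square integrable the average is a junk value, but
   then the right-hand side is [+oo]. *)
Lemma sqnorm_avg_le p j (u : vfun p) k : vmeas u -> cube k ->
  (sqnorm (avg j u k))%:E <=
  \int[leb j]_(t in cube) (sqnorm (u (set_prefix t k)))%:E.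
Proof.
move=> um kc; have mCj := @measurable_cube R j.
have ms a : measurable_fun cube (fun t : j.-tuple R =>
    (cabs (u (set_prefix t k) a ord0) ^+ 2)%:E).
  apply/measurable_EFinP.
  exact: (measurable_cabs_sqr (cmeas_slice kc (um a))).
have -> : \int[leb j]_(t in cube) (sqnorm (u (set_prefix t k)))%:E =
    \sum_(a < p) \int[leb j]_(t in cube) (cabs (u (set_prefix t k) a ord0) ^+ 2)%:E.
  rewrite -ge0_integral_sum//; last by move=> a t _; rewrite lee_fin sqr_ge0.
  by apply: eq_integral => t _; rewrite sumEFin.
rewrite /sqnorm -sumEFin; apply: lee_sum => a _; rewrite mxE.
have sm := cmeas_slice (j := j) kc (um a).
have [foo|] := ltP (\int[leb j]_(t in cube)
    (cabs (u (set_prefix t k) a ord0) ^+ 2)%:E) +oo; last first.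
  by rewrite leye_eq => /eqP ->; rewrite leey.
exact: (cabs_cube_integral_sqr_le (cintegrable_sqr sm foo)).
Qed.

(** The square of an average is at most the average of the squares on each slice, and
    [ge0_integral_prefix] collapses the resulting double integral. *)
Lemma energy_avg p j (u : vfun p) : (j <= N)%N -> vmeas u -> energy (avg j u) <= energy u.
Proof.
move=> jN um; rewrite /energy -(@ge0_integral_prefix _ j N (fun k => (sqnorm (u k))%:E))//.
- apply: ge0_le_integral => //.
  + by move=> k _; rewrite lee_fin sqnorm_ge0.
  + by apply: emeasurable_sqnorm; exact: vmeas_avg.
  + apply: (@measurable_prefix_integral _ j N (fun k => (sqnorm (u k))%:E)
      (emeasurable_sqnorm um)).
    by move=> k _; rewrite lee_fin sqnorm_ge0.
  + by move=> k kc; exact: sqnorm_avg_le.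
- exact: emeasurable_sqnorm.
- by move=> k _; rewrite lee_fin sqnorm_ge0.
Qed.

Lemma energy_mulmx p q (F : mfun p q) : continuous_mx F ->
  exists2 c : R, (0 <= c)%R &
    forall u : vfun q, vmeas u -> energy (fun k => F k *m u k) <= c%:E * energy u.
Proof.
move=> Fc; have [K K0 FK] := continuous_mx_bounded Fc.
exists (p%:R * (q%:R * K) ^+ 2)%R; first by rewrite mulr_ge0 ?sqr_ge0.
move=> u um; apply: energy_le => //; first by rewrite mulr_ge0 ?sqr_ge0.
- by apply: vmeas_mulmx => // a b; exact: continuous_cube_cmeas.
- by move=> k kc; apply: sqnorm_mulmx => [|a b]; [exact: ltW|exact: FK].
Qed.

Lemma L2norm_sqr p (u : vfun p) : L2norm u `^ 2 = energy u.
Proof.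
rewrite /L2norm poweR_Lnorm// /energy [RHS]integral_mkcond.
apply: eq_integral => k _; rewrite !patchE; case: ifP => _ /=.
  rewrite powR_mulrn ?normr_ge0// real_normK ?num_real//.
  by rewrite cV_norm_sqr.
by rewrite normr0 powR0.
Qed.

Lemma L2normE p (u : vfun p) : L2norm u = energy u `^ 2^-1.
Proof.
by rewrite -L2norm_sqr -poweRrM divff ?pnatr_eq0// poweRe1//; exact: Lnorm_ge0.
Qed.

Lemma L2E p (u : vfun p) : L2 u <-> vmeas u /\ energy u < +oo.
Proof.
rewrite /L2; split => -[um uoo]; split => //.
  by rewrite -L2norm_sqr; exact: poweR_lty.
by rewrite L2normE; exact: poweR_lty.
Qed.

Lemma L2norm_le p q (u : vfun p) (v : vfun q) (c : R) : (0 <= c)%R ->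
  L2norm v <= c%:E * L2norm u <-> energy v <= (c ^+ 2)%:E * energy u.
Proof.
move=> c0.
have n0 r (w : vfun r) : 0 <= L2norm w by exact: Lnorm_ge0.
have cn0 : 0 <= c%:E * L2norm u by rewrite mule_ge0 ?lee_fin.
have sq : (c%:E * L2norm u) `^ 2 = (c ^+ 2)%:E * energy u.
  by rewrite poweRM ?lee_fin// L2norm_sqr poweR_EFin powR_mulrn.
split => uv.
  rewrite -sq -L2norm_sqr; apply: gt0_ler_poweR => //.
  - by rewrite in_itv /= leey andbT.
  - by rewrite in_itv /= leey andbT.
have r12 (x : \bar R) : 0 <= x -> x = (x `^ 2) `^ 2^-1.
  by move=> x0; rewrite -poweRrM divff// poweRe1.
rewrite (r12 (L2norm v))// (r12 (c%:E * L2norm u))// sq L2norm_sqr.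
apply: gt0_ler_poweR => //.
- by rewrite in_itv /= leey andbT energy_ge0.
- by rewrite in_itv /= leey andbT mule_ge0 ?energy_ge0 ?lee_fin ?sqr_ge0.
Qed.

End Energy.

(** * Bounded operators on L2 *)

Section RegularOperators.
Context {R : realType} {N : nat}.
Local Notation C := (Cplx R).
Local Notation vfun p := (N.-tuple R -> 'cV[C]_p).
Local Notation mfun p q := (N.-tuple R -> 'M[C]_(p, q)).

Let mC : measurable (cube : set (N.-tuple R)). Proof. exact: measurable_cube. Qed.

(** Tonelli for the indicator of a null set: its slice integrals are nonnegative and integrate to 0,
    so almost every slice meets the null set in a null set. *)
Lemma ae_slice j (P : set (N.-tuple R)) : (j <= N)%N ->
  {ae leb N, forall k, cube k -> P k} ->
  {ae leb N, forall k, cube k ->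
     {ae leb j, forall t, cube t -> P (set_prefix t k)}}.
Proof.
move=> jN [Z [mZ Z0 PZ]]; have mCj := @measurable_cube R j.
pose f k : \bar R := (\1_Z k)%:E.
have mf : measurable_fun cube f.
  by apply/measurable_EFinP; exact: measurable_indic.
have f0 k : (0 <= f k)%E by rewrite lee_fin.
have : (\int[leb N]_(k in cube) f k = 0)%E.
  rewrite integral_indic//; apply/eqP; rewrite -measure_le0 -Z0.
  by apply: le_measure => //; rewrite inE//; exact: measurableI.
rewrite -(ge0_integral_prefix jN mf)//; set q := fun k => _.
have mq : measurable_fun cube q by exact: measurable_prefix_integral.
have q0 k : (0 <= q k)%E by exact: integral_ge0.
move=> iq0.
have /(ae_eq_integral_abs (leb N) mC mq) :
    (\int[leb N]_(k in cube) `|q k| = 0)%E.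
  by rewrite -[RHS]iq0; apply: eq_integral => k _; rewrite gee0_abs.
apply: filterS => k /= qk kc; have {}qk := qk kc.
have ms : measurable_fun cube (fun t : j.-tuple R => f (set_prefix t k)).
  exact: measurable_fun_set_prefix.
have /(ae_eq_integral_abs (leb j) mCj ms) :
    (\int[leb j]_(t in cube) `|f (set_prefix t k)| = 0)%E.
  by rewrite -[RHS]qk; apply: eq_integral => t _; rewrite gee0_abs.
apply: filterS => t /= ft tc; have {}ft := ft tc.
apply: contrapT => nP; have Zt : Z (set_prefix t k).
  by apply: PZ => /= /(_ (cube_set_prefix tc kc)).
by move: ft; rewrite /f indicE mem_set// => -[] /eqP; rewrite oner_eq0.
Qed.

(** The slice energies integrate to the energy of [u], hence are finite almost everywhere, and a
    square integrable slice is integrable. *)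
Lemma ae_slice_integrable p j (u : vfun p) : (j <= N)%N ->
  vmeas u -> (energy u < +oo)%E ->
  {ae leb N, forall k, cube k -> slice_integrable j u k}.
Proof.
move=> jN um uoo; have mCj := @measurable_cube R j.
have mn := emeasurable_sqnorm um.
have n0 k : cube k -> (0 <= (sqnorm (u k))%:E)%E by rewrite lee_fin sqnorm_ge0.
pose q k := (\int[leb j]_(t in cube) (sqnorm (u (set_prefix t k)))%:E)%E.
have mq : measurable_fun cube q.
  exact: (@measurable_prefix_integral _ j N (fun k => (sqnorm (u k))%:E)).
have q0 k : (0 <= q k)%E.
  by apply: integral_ge0 => t _; rewrite lee_fin sqnorm_ge0.
have iq : (leb N).-integrable cube q.
  apply/integrableP; split => //.
  under eq_integral do rewrite gee0_abs//.
  by rewrite (@ge0_integral_prefix _ j N (fun k => (sqnorm (u k))%:E)).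
apply: filterS (integrable_ae mC iq) => k qk kc a b.
rewrite (ord1 b); apply: cintegrable_sqr; first exact: (cmeas_slice kc (um a)).
apply: (@le_lt_trans _ _ (q k)); last by rewrite -ge0_fin_numE// qk.
apply: ge0_le_integral => //.
- by move=> t _; rewrite lee_fin sqr_ge0.
- apply/measurable_EFinP.
  exact: (measurable_cabs_sqr (cmeas_slice kc (um a))).
- exact: (measurable_fun_set_prefix (f := fun k => (sqnorm (u k))%:E) kc mn).
- by move=> t tc; rewrite lee_fin cabs_le_sqnorm.
Qed.

Lemma avg_ae_eq p j (u v : vfun p) : (j <= N)%N -> vmeas u -> vmeas v ->
  eqL2 u v -> eqL2 (avg j u) (avg j v).
Proof.
move=> jN um vm /(@ae_slice j (fun k => u k = v k) jN).
apply: filterS => k uv kc; have {}uv := uv kc.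
have mCj := @measurable_cube R j.
apply/matrixP => a b; rewrite (ord1 b) !mxE /cube_integral.
have [uR uI] := cmeas_slice (j := j) kc (um a).
have [vR vI] := cmeas_slice (j := j) kc (vm a).
congr Complex; congr fine; apply: ae_eq_integral => //; try exact/measurable_EFinP.
all: by apply: filterS uv => t /= tuv tc; rewrite tuv.
Qed.

(** The first three clauses range over all measurable functions, of finite energy or not; linearity
    is confined to L2, where almost every slice is integrable. The two sizes differ because the
    averages live in the intermediate dimensions [m j]. *)
Definition regular_op p q (T : vfun p -> vfun q) : Prop :=
  [/\ forall u, vmeas u -> vmeas (T u),
      exists2 c : R, 0 <= c & forall u, vmeas u -> (energy (T u) <= c%:E * energy u)%E,
      forall u v, vmeas u -> vmeas v -> eqL2 u v -> eqL2 (T u) (T v) &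
      forall (a : C) u v, L2 u -> L2 v ->
        eqL2 (T (fun k => a *: u k + v k)) (fun k => a *: T u k + T v k)].

Lemma eqL2_pointwise p (u v : vfun p) : (forall k, cube k -> u k = v k) ->
  eqL2 u v.
Proof. by move=> uv; apply: aeW => k; exact: uv. Qed.

Lemma L2_lin p (a : C) (u v : vfun p) :
  L2 u -> L2 v -> L2 (fun k => a *: u k + v k).
Proof.
move=> /L2E[um uoo] /L2E[vm voo]; apply/L2E.
have aum := vmeasZ a um.
split; first exact: vmeasD.
apply: le_lt_trans (energy_D aum vm) _; rewrite energy_Z//.
by rewrite lte_add_pinfty// lte_mul_pinfty// ?lee_fin ?sqr_ge0// lte_mul_pinfty
  ?lee_fin ?sqr_ge0.
Qed.

Lemma L2_regular p q (T : vfun p -> vfun q) (u : vfun p) : regular_op T ->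
  L2 u -> L2 (T u).
Proof.
move=> [Tm [c c0 Tc] _ _] /L2E[um uoo]; apply/L2E; split; first exact: Tm.
by apply: le_lt_trans (Tc u um) _; rewrite lte_mul_pinfty ?lee_fin.
Qed.

Lemma regular_op_comp p q r (T : vfun p -> vfun q) (S : vfun q -> vfun r) :
  regular_op T -> regular_op S -> regular_op (fun u => S (T u)).
Proof.
move=> rT rS; have [Tm [c c0 Tc] Te Tl] := rT; have [Sm [d d0 Sd] Se Sl] := rS.
split.
- by move=> u um; apply: Sm; exact: Tm.
- exists (d * c); first exact: mulr_ge0.
  move=> u um; apply: le_trans (Sd _ (Tm _ um)) _.
  by rewrite EFinM -muleA lee_wpmul2l ?lee_fin// Tc.
- by move=> u v um vm uv; apply: Se; [exact: Tm|exact: Tm|exact: Te].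
- move=> a u v uL vL.
  have uvL := L2_lin a uL vL.
  (* Linearity of [T] is an equality almost everywhere, which [S] must respect before its own
     linearity can be used. *)
  apply: (ae_eq_trans _ (Sl a _ _ (L2_regular rT uL) (L2_regular rT vL))).
  apply: Se; last exact: Tl.
    by apply: Tm; case/L2E: uvL.
  have := L2_lin a (L2_regular rT uL) (L2_regular rT vL).
  by case/L2E.
Qed.

Lemma regular_op_add p q (S T : vfun p -> vfun q) :
  regular_op S -> regular_op T -> regular_op (fun u k => S u k + T u k).
Proof.
move=> [Sm [c c0 Sc] Se Sl] [Tm [d d0 Td] Te Tl]; split.
- by move=> u um; apply: vmeasD; [exact: Sm|exact: Tm].
- exists (2 * c + 2 * d); first by rewrite addr_ge0// mulr_ge0.
  move=> u um; apply: le_trans (energy_D (Sm u um) (Tm u um)) _.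
  have c20 : (0 <= (2 * c)%:E)%E by rewrite lee_fin mulr_ge0.
  have d20 : (0 <= (2 * d)%:E)%E by rewrite lee_fin mulr_ge0.
  rewrite EFinD (ge0_muleDl _ c20 d20) !EFinM -!muleA.
  by rewrite leeD// lee_wpmul2l ?lee_fin// ?Sc// Td.
- move=> u v um vm uv.
  by apply: filterS2 (Se u v um vm uv) (Te u v um vm uv) => k su tu kc;
    rewrite su// tu.
- move=> a u v uL vL.
  apply: filterS2 (Sl a u v uL vL) (Tl a u v uL vL) => k su tu kc.
  by rewrite su// tu// scalerDr addrACA.
Qed.

Lemma regular_op_id p : regular_op (fun u : vfun p => u).
Proof.
split => //.
- by exists 1 => // u _; rewrite mul1e.
- by move=> a u v _ _; exact: ae_eq_refl.
Qed.

Lemma regular_op0 p q : regular_op (fun (_ : vfun p) => (fun=> 0) : vfun q).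
Proof.
split.
- move=> u _ i; apply: (@cmeas_ext _ _ (fun=> 0)); last exact: cmeas_cst.
  by move=> k _; rewrite mxE.
- exists 0 => // u _; rewrite mul0e /energy integral0_eq// => k _.
  by congr EFin; apply/eqP; rewrite sqnorm_eq0.
- by move=> u v _ _ _; exact: ae_eq_refl.
- by move=> a u v _ _; apply: eqL2_pointwise => k _; rewrite scaler0 addr0.
Qed.

Lemma regular_op_mul p q (F : mfun p q) : continuous_mx F ->
  regular_op (fun (u : vfun q) k => F k *m u k).
Proof.
move=> Fc; split.
- by move=> u um; apply: vmeas_mulmx => // a b; exact: continuous_cube_cmeas.
- exact: energy_mulmx.
- by move=> u v _ _; apply: filterS => k uv kc; rewrite uv.
- move=> a u v _ _; apply: eqL2_pointwise => k _.
  by rewrite mulmxDr scalemxAr.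
Qed.

Lemma regular_op_avg p j : (j <= N)%N -> regular_op (fun u : vfun p => avg j u).
Proof.
move=> jN; split.
- by move=> u; exact: vmeas_avg.
- by exists 1 => // u um; rewrite mul1e energy_avg.
- by move=> u v um vm; exact: avg_ae_eq.
- move=> a u v /L2E[um uoo] /L2E[vm voo].
  apply: filterS2 (ae_slice_integrable jN um uoo)
    (ae_slice_integrable jN vm voo) => k iu iv kc.
  rewrite (@avgD _ _ _ _ j (fun k => a *: u k)) ?avgZ//; try exact: iv; try exact: iu.
  by apply: slice_integrableZ; exact: iu.
Qed.

Definition avg_op p q j (X : mfun p q) (Y : mfun q p) (u : vfun p) : vfun p :=
  fun k => X k *m avg j (fun k => Y k *m u k) k.

Lemma regular_op_avg_op p q j (X : mfun p q) (Y : mfun q p) :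
  (j <= N)%N -> continuous_mx X -> continuous_mx Y -> regular_op (avg_op j X Y).
Proof.
move=> jN Xc Yc; apply: (@regular_op_comp _ _ _
    (fun u => avg j (fun k => Y k *m u k)) (fun w k => X k *m w k)).
  apply: (@regular_op_comp _ _ _ (fun u k => Y k *m u k) (avg j)).
    exact: regular_op_mul.
  exact: regular_op_avg.
exact: regular_op_mul.
Qed.

Lemma regular_op_sum p q (I : eqType) (r : seq I) (T : I -> vfun p -> vfun q) :
  (forall i, i \in r -> regular_op (T i)) ->
  regular_op (fun u k => \sum_(i <- r) T i u k).
Proof.
elim: r => [_|i r IH Tr].
  rewrite (_ : (fun _ => _) = (fun _ => fun=> 0)); first exact: regular_op0.
  by apply/funext => u; apply/funext => k; rewrite big_nil.
rewrite (_ : (fun _ => _) = (fun u k => T i u k + \sum_(i <- r) T i u k)); last first.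
  by apply/funext => u; apply/funext => k; rewrite big_cons.
apply: regular_op_add; first by apply: Tr; rewrite mem_head.
by apply: IH => l lr; apply: Tr; rewrite in_cons lr orbT.
Qed.

Lemma regular_bounded_operator p (T : vfun p -> vfun p) :
  regular_op T -> bounded_operator T.
Proof.
move=> rT; have [Tm [c c0 Tc] Te Tl] := rT; split => //.
- by move=> u; exact: L2_regular.
- by move=> u v /L2E[um _] /L2E[vm _]; exact: Te.
- exists (Num.sqrt c) => u /L2E[um uoo].
  by apply/L2norm_le; rewrite ?sqrtr_ge0// sqr_sqrtr// Tc.
Qed.

End RegularOperators.

(** * The factorization and its inverse *)

Section RankReduction.
Context {R : realType} {N : nat}.
Local Notation C := (Cplx R).
Local Notation vfun p := (N.-tuple R -> 'cV[C]_p).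
Local Notation mfun p q := (N.-tuple R -> 'M[C]_(p, q)).

(** A factor constant along the slices can be taken out of the average; what stays inside is [Y X],
    and this is how the matrices E_j arise. *)
Lemma avg_mul_update p q r j (Y : mfun q p) (u : vfun p) (X : mfun p r)
    (w : vfun r) k : cube k -> continuous_mx X -> continuous_mx Y -> slice_integrable j u k ->
  slice_constant j w k ->
  avg j (fun k => Y k *m (u k + X k *m w k)) k =
  avg j (fun k => Y k *m u k) k + avg j (fun k => Y k *m X k) k *m w k.
Proof.
move=> kc Xc Yc iu wk.
have YXc := continuous_mxM Yc Xc.
have iYX : slice_integrable j (fun k => Y k *m X k) k.
  exact: (continuous_mx_slice_integrable _ kc YXc).
rewrite -(avgMr iYX wk) -avgD; last 2 first.
- exact: slice_integrableMl.
- exact: slice_integrableMr.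
by apply: avg_ext => t _; rewrite mulmxDr mulmxA.
Qed.

Lemma avg_mul_updates p q j (m : nat -> nat) (s : seq nat) (Y : mfun q p)
    (X : forall i, mfun p (m i)) (w : forall i, vfun (m i)) (u : vfun p) k :
  cube k -> continuous_mx Y -> (forall i, i \in s -> continuous_mx (X i)) ->
  slice_integrable j u k -> (forall i, i \in s -> slice_constant j (w i) k) ->
  avg j (fun k => Y k *m (u k + \sum_(i <- s) X i k *m w i k)) k =
  avg j (fun k => Y k *m u k) k +
  \sum_(i <- s) avg j (fun k => Y k *m X i k) k *m w i k.
Proof.
move=> kc Yc; elim: s u => [|i s IH] u Xc iu wc.
  rewrite big_nil addr0; apply: avg_ext => t _; by rewrite big_nil addr0.
have Xi : continuous_mx (X i) by apply: Xc; rewrite mem_head.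
have wi : slice_constant j (w i) k by apply: wc; rewrite mem_head.
rewrite big_cons addrA -avg_mul_update// -IH.
- by apply: avg_ext => t _; rewrite big_cons addrA.
- by move=> l ls; apply: Xc; rewrite in_cons ls orbT.
- apply: (slice_integrableD (F := u)) => //.
  by apply: slice_integrableMr => //; exact: continuous_mx_slice_integrable.
- by move=> l ls; apply: wc; rewrite in_cons ls orbT.
Qed.

Definition avg_update p q j (X : mfun p q) (Y : mfun q p) (u : vfun p) : vfun p :=
  fun k => u k + avg_op j X Y u k.

Lemma regular_avg_update p q j (X : mfun p q) (Y : mfun q p) :
  (j <= N)%N -> continuous_mx X -> continuous_mx Y -> regular_op (avg_update j X Y).
Proof.
move=> jN Xc Yc; apply: (regular_op_add (@regular_op_id R N p)).
exact: regular_op_avg_op.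
Qed.

(** This identity is the reason for the recursion defining A_{ij}. With H_i = <Y Z_i>, the
    coefficient Z_i - X E^-1 H_i is such that the update adds back exactly X E^-1 H_i and restores
    Z_i. For Z_i = A_{i,j-1} and w_i = <B_i u>_i it becomes Q_{j-1} = P_j Q_j. *)
Lemma avg_update_reduce p q j (m : nat -> nat) (s : seq nat) (X : mfun p q)
    (Y : mfun q p) (E : mfun q q) (Z : forall i, mfun p (m i))
    (w : forall i, vfun (m i)) (u : vfun p) k :
  (forall k, E k = 1%:M + avg j (fun k => Y k *m X k) k) ->
  (forall k, cube k -> \det (E k) != 0) ->
  continuous_mx X -> continuous_mx Y -> (forall i, i \in s -> continuous_mx (Z i)) ->
  cube k -> slice_integrable j u k ->
  (forall i, i \in s -> slice_constant j (w i) k) ->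
  avg_update j X Y (fun k => u k + \sum_(i <- s)
    (Z i k - X k *m invmx (E k) *m avg j (fun k => Y k *m Z i k) k) *m w i k) k =
  u k + (avg_op j X Y u k + \sum_(i <- s) Z i k *m w i k).
Proof.
move=> EE E0 Xc Yc Zc kc iu wc.
have Ec : continuous_mx E.
  apply: (@continuous_mx_ext _ _ _ _ (fun k => 1%:M + avg j (fun k => Y k *m X k) k)).
    by move=> k' _; rewrite EE.
  by apply: continuous_mxD; [exact: continuous_mx_cst|exact/continuous_mx_avg/continuous_mxM].
have EVc := continuous_mx_inv E0 Ec.
have YXc := continuous_mxM Yc Xc.
have iX := continuous_mx_slice_integrable j kc YXc.
have sE : slice_constant j E k.
  move=> t tc; rewrite !EE.
  by rewrite (avg_slice_constant (fun k => Y k *m X k) k (leqnn j) tc).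
have uE : E k \in unitmx by rewrite unitmxE unitfE E0.
pose V i k := invmx (E k) *m avg j (fun k => Y k *m Z i k) k.
have sV i : slice_constant j (V i) k.
  move=> t tc; rewrite /V (sE t tc).
  by rewrite (avg_slice_constant (fun k => Y k *m Z i k) k (leqnn j) tc).
have Zc' i : i \in s ->
    continuous_mx (fun k => Z i k - X k *m invmx (E k) *m avg j (fun k => Y k *m Z i k) k).
  move=> si; have Hc := continuous_mx_avg (j := j) (continuous_mxM Yc (Zc i si)).
  exact: (continuous_mxD (Zc i si)
    (continuous_mxN (continuous_mxM (continuous_mxM Xc EVc) Hc))).
(* Since <Y X> = E - 1, the left side is H_i - (E - 1) E^-1 H_i = E^-1 H_i. *)
have avgZ' i : i \in s -> avg j (fun k => Y k *m (Z i k -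
      X k *m invmx (E k) *m avg j (fun k => Y k *m Z i k) k)) k = V i k.
  move=> si; have iZ := continuous_mx_slice_integrable j kc (continuous_mxM Yc (Zc i si)).
  have iXV := slice_integrableMr iX (sV i).
  transitivity (avg j (fun k => Y k *m Z i k + -1 *: (Y k *m X k *m V i k)) k).
    by apply: avg_ext => t _; rewrite scaleN1r mulmxBr /V !mulmxA.
  rewrite (avgD iZ (slice_integrableZ _ iXV)) (avgZ _ iXV) (avgMr iX (sV i)).
  have -> : avg j (fun k => Y k *m X k) k = E k - 1%:M by rewrite EE addrC addKr.
  by rewrite scaleN1r mulmxBl mul1mx opprB /V mulmxA mulmxV// mul1mx addrC subrK.
rewrite /avg_update /avg_op (avg_mul_updates kc Yc Zc' iu wc).
rewrite mulmxDr -!addrA; congr (_ + _).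
rewrite [LHS]addrCA; congr (_ + _).
rewrite mulmx_sumr -big_split; apply: eq_big_seq => i si /=.
by rewrite avgZ'// mulmxBl /V !mulmxA subrK.
Qed.

Definition regular_inverse p (T S : vfun p -> vfun p) : Prop :=
  [/\ regular_op T, regular_op S &
      forall u, L2 u -> eqL2 (S (T u)) u /\ eqL2 (T (S u)) u].

Lemma regular_inverse_comp p (T T' S S' : vfun p -> vfun p) :
  regular_inverse T T' -> regular_inverse S S' ->
  regular_inverse (fun u => T (S u)) (fun u => S' (T' u)).
Proof.
move=> [rT rT' TT'] [rS rS' SS']; split; [exact: regular_op_comp..|].
(* Cancelling the inner pair under an outer operator that respects equality almost everywhere serves
   both orders of composition. *)
have trans (S1 S2 T1 T2 : vfun p -> vfun p) : regular_op S1 -> regular_op S2 ->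
    regular_op T1 -> regular_op T2 ->
    (forall u, L2 u -> eqL2 (S1 (S2 u)) u) ->
    (forall u, L2 u -> eqL2 (T1 (T2 u)) u) ->
    forall u, L2 u -> eqL2 (S1 (T1 (T2 (S2 u)))) u.
  move=> r1 r2 r3 r4 S12 T12 u uL.
  apply: (ae_eq_trans _ (S12 u uL)).
  have [_ _ e1 _] := r1.
  have S2u := L2_regular r2 uL.
  have T2u := L2_regular r3 (L2_regular r4 S2u).
  apply: e1; [by case/L2E: T2u|by case/L2E: S2u|exact: T12].
move=> u uL; split.
  by apply: (trans S' S T' T) => // w wL; [case: (SS' w wL)|case: (TT' w wL)].
by apply: (trans T T' S S') => // w wL; [case: (TT' w wL)|case: (SS' w wL)].
Qed.

Lemma regular_inverse_mul p (F : mfun p p) : continuous_mx F ->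
  (forall k, cube k -> \det (F k) != 0) ->
  regular_inverse (fun (u : vfun p) k => F k *m u k)
                  (fun (u : vfun p) k => invmx (F k) *m u k).
Proof.
move=> Fc F0; split; [exact: regular_op_mul|exact/regular_op_mul/continuous_mx_inv|].
move=> u _; split; apply: eqL2_pointwise => k kc; rewrite mulmxA.
  by rewrite mulVmx ?mul1mx// unitmxE unitfE F0.
by rewrite mulmxV ?mul1mx// unitmxE unitfE F0.
Qed.

(* Woodbury: [I + X<Y .>] is inverted by [I - X E^-1 <Y .>], [E = I + <Y X>],
   because [E] and [<Y u>] are constant along the slices. *)
Lemma regular_inverse_avg_update p q j (X : mfun p q) (Y : mfun q p) :
  (j <= N)%N -> continuous_mx X -> continuous_mx Y ->
  let E k := 1%:M + avg j (fun k => Y k *m X k) k in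
  (forall k, cube k -> \det (E k) != 0) ->
  regular_inverse (avg_update j X Y)
                  (avg_update j (fun k => - (X k *m invmx (E k))) Y).
Proof.
move=> jN Xc Yc E E0.
have Ec : continuous_mx E.
  apply: continuous_mxD; first exact: continuous_mx_cst.
  exact/continuous_mx_avg/continuous_mxM.
have EVc := continuous_mx_inv E0 Ec.
have X'c : continuous_mx (fun k => - (X k *m invmx (E k))).
  by apply: continuous_mxN; exact: continuous_mxM.
split; [exact: regular_avg_update..|].
move=> u /L2E[um uoo]; have iu := ae_slice_integrable jN um uoo.
have EV k : cube k -> E k *m invmx (E k) = 1%:M.
  by move=> kc; rewrite mulmxV// unitmxE unitfE E0.
have VE k : cube k -> invmx (E k) *m E k = 1%:M.
  by move=> kc; rewrite mulVmx// unitmxE unitfE E0.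
have wk k : slice_constant j (avg j (fun k => Y k *m u k)) k.
  exact: avg_slice_constant.
split; apply: filterS iu => k iu kc; have {}iu := iu kc.
  rewrite {1}/avg_update /avg_op /avg_update /avg_op avg_mul_update//.
  set w := avg j (fun k => Y k *m u k) k.
  rewrite -{2}[w]mul1mx -mulmxDl -/(E k) mulmxA mulNmx -mulmxA VE// mulmx1.
  by rewrite mulNmx addrK.
rewrite {1}/avg_update /avg_op /avg_update /avg_op avg_mul_update//.
set w := avg j (fun k => Y k *m u k) k.
have -> : avg j (fun k => Y k *m - (X k *m invmx (E k))) k =
    - (avg j (fun k => Y k *m X k) k *m invmx (E k)).
  have iYX : slice_integrable j (fun k => Y k *m X k) k.
    exact/continuous_mx_slice_integrable/continuous_mxM.
  have sV : slice_constant j (fun k => invmx (E k)) k.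
    move=> t tc.
    have sG := avg_slice_constant (fun k => Y k *m X k) k (leqnn j) tc.
    by rewrite /E sG.
  transitivity (avg j (fun k => -1 *: (Y k *m X k *m invmx (E k))) k).
    by apply: avg_ext => t _; rewrite scaleN1r mulmxN mulmxA.
  by rewrite avgZ ?(avgMr iYX sV) ?scaleN1r//; exact: (slice_integrableMr iYX sV).
rewrite (_ : avg j _ k = E k - 1%:M); last by rewrite /E addrC addKr.
(* As (E - 1) E^-1 = 1 - E^-1, the average of the inner function is E^-1 w. *)
rewrite mulmxBl EV// mul1mx opprB mulmxBl mul1mx.
rewrite addrCA subrr addr0 mulNmx -mulmxA.
by rewrite addrNK.
Qed.

End RankReduction.

(** * The factors P_j, the remainders Q_j, and the inverse of the product *)

Section Factorization.
Context {R : realType} {N M : nat} (m : nat -> nat).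
Local Notation C := (Cplx R).
Local Notation vfun p := (N.-tuple R -> 'cV[C]_p).
Local Notation mfun p q := (N.-tuple R -> 'M[C]_(p, q)).
Variables (A0 : mfun M M) (A : forall j, mfun M (m j)) (B : forall j, mfun (m j) M).
Hypotheses (A0c : continuous_mx A0)
  (Ac : forall j, (1 <= j <= N)%N -> continuous_mx (A j))
  (Bc : forall j, (1 <= j <= N)%N -> continuous_mx (B j)).

Local Notation red := (reduced A0 A B).

Lemma step_det_neq0 j : ~ step_stops A0 A B j ->
  forall k, cube k -> step_det A0 A B j k != 0.
Proof. by move=> ns k kc; apply/eqP => k0; apply: ns; exists k. Qed.

Lemma continuous_mx_step_mx j (X : mfun M (m j)) : (1 <= j <= N)%N -> continuous_mx X ->
  continuous_mx (step_mx B X).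
Proof.
move=> jN Xc; apply: continuous_mxD; first exact: continuous_mx_cst.
by apply: continuous_mx_avg; apply: continuous_mxM => //; exact: Bc.
Qed.

Lemma continuous_mx_reduced i j : (1 <= i <= N)%N -> (j <= N)%N ->
  (forall l, (l <= j)%N -> ~ step_stops A0 A B l) -> continuous_mx (red i j).
Proof.
elim: j i => [|j IH] i iN jN ns /=.
  apply: continuous_mxM; last exact: Ac.
  by apply: continuous_mx_inv => // k kc; exact: (step_det_neq0 (ns 0 _)).
have ns' l : (l <= j)%N -> ~ step_stops A0 A B l by move=> lj; apply: ns; exact: leqW.
have Xc : continuous_mx (red j.+1 j) by apply: IH => //; exact: ltnW.
have Zc : continuous_mx (red i j) by apply: IH => //; exact: ltnW.
have Bjc : continuous_mx (B j.+1) by exact: Bc.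
have Ec := continuous_mx_step_mx (j := j.+1) jN Xc.
have EVc := continuous_mx_inv (step_det_neq0 (ns j.+1 (leqnn _))) Ec.
have Hc := continuous_mx_avg (j := j.+1) (continuous_mxM Bjc Zc).
exact: (continuous_mxD Zc (continuous_mxN (continuous_mxM (continuous_mxM Xc EVc) Hc))).
Qed.

(* [step_op j], [remainder_op j] and [steps_op j] are P_j, Q_j and A_0 P_1 ... P_j. *)
Definition step_op j : vfun M -> vfun M := avg_update j (red j j.-1) (B j).

Definition remainder_op j (u : vfun M) : vfun M := fun k =>
  u k + \sum_(j.+1 <= i < N.+1) avg_op i (red i j) (B i) u k.

Fixpoint steps_op j (u : vfun M) : vfun M :=
  if j is j'.+1 then steps_op j' (step_op j'.+1 u) else fun k => A0 k *m u k.

Lemma calA_remainder u k : cube k -> ~ step_stops A0 A B 0 ->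
  calA A0 A B u k = A0 k *m remainder_op 0 u k.
Proof.
move=> kc ns; rewrite /calA mulmxDr mulmx_sumr; congr (_ + _).
apply: eq_bigr => i _; rewrite /avg_op /= !mulmxA mulmxV ?mul1mx//.
by rewrite unitmxE unitfE; exact: (step_det_neq0 ns).
Qed.

(** The relation Q_j = P_{j+1} Q_{j+1} at one point. The term i = j+1 of the sum is split off as the
    averaging part of P_{j+1}; the other averages are constant along slices in the first j+1
    variables, as [avg_update_reduce] demands. *)
Lemma remainder_step j u k : (j < N)%N ->
  (forall l, (l <= j.+1)%N -> ~ step_stops A0 A B l) -> cube k ->
  slice_integrable j.+1 u k ->
  remainder_op j u k = step_op j.+1 (remainder_op j.+1 u) k.
Proof.
move=> jN ns kc iu.
have ns' l : (l <= j)%N -> ~ step_stops A0 A B l.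
  by move=> lj; apply: ns; exact: leqW.
have Xc : continuous_mx (red j.+1 j) by apply: continuous_mx_reduced => //; exact: ltnW.
have Bjc : continuous_mx (B j.+1) by exact: Bc.
have E0 : forall k, cube k -> \det (step_mx B (red j.+1 j) k) != 0.
  exact: (step_det_neq0 (ns j.+1 _)).
have rng i : i \in index_iota j.+2 N.+1 -> (1 <= i <= N)%N /\ (j.+1 <= i)%N.
  rewrite mem_index_iota ltnS => /andP[ji iN]; rewrite iN andbT.
  by split; [exact: leq_trans ji|exact: ltnW].
transitivity (u k + (avg_op j.+1 (red j.+1 j) (B j.+1) u k +
  \sum_(j.+2 <= i < N.+1) red i j k *m avg i (fun k => B i k *m u k) k)).
  by rewrite /remainder_op big_ltn.
have Zc i : i \in index_iota j.+2 N.+1 -> continuous_mx (red i j).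
  by move=> /rng[iN ji]; apply: continuous_mx_reduced => //; exact: ltnW.
have wc i : i \in index_iota j.+2 N.+1 ->
    slice_constant j.+1 (avg i (fun k => B i k *m u k)) k.
  by move=> /rng[iN ji]; exact: avg_slice_constant.
exact: (esym (@avg_update_reduce _ _ _ _ _ m _ _ _ (step_mx B (red j.+1 j))
  _ _ _ _ (fun=> erefl) E0 Xc Bjc Zc kc iu wc)).
Qed.

Lemma regular_step_op j : (1 <= j <= N)%N ->
  (forall l, (l < j)%N -> ~ step_stops A0 A B l) -> regular_op (step_op j).
Proof.
move=> /andP[j0 jN] ns; apply: regular_avg_update => //; last by apply: Bc; rewrite j0.
apply: continuous_mx_reduced; rewrite ?j0//; first by apply: leq_trans jN; exact: leq_pred.
by move=> l lj; apply: ns; rewrite (leq_ltn_trans lj)// prednK.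
Qed.

Lemma regular_steps_op j : (j <= N)%N ->
  (forall l, (l <= j)%N -> ~ step_stops A0 A B l) -> regular_op (steps_op j).
Proof.
elim: j => [|j IH] jN ns /=; first exact: regular_op_mul.
apply: (@regular_op_comp _ _ _ _ _ (step_op j.+1)).
  by apply: regular_step_op => // l lj; apply: ns; exact: ltnW.
by apply: IH; [exact: ltnW|move=> l lj; apply: ns; exact: leqW].
Qed.

Lemma regular_remainder_op j : (j <= N)%N ->
  (forall l, (l <= j)%N -> ~ step_stops A0 A B l) -> regular_op (remainder_op j).
Proof.
move=> jN ns; apply: (regular_op_add (@regular_op_id R N M)).
apply: regular_op_sum => i; rewrite mem_index_iota ltnS => /andP[ji iN].
have iN' : (1 <= i <= N)%N by rewrite iN (leq_trans _ ji).
apply: regular_op_avg_op => //; [exact: continuous_mx_reduced|exact: Bc].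
Qed.

(** In the induction, [remainder_step] changes the argument of [steps_op j] on the null set of
    points with a slice of [u] that is not integrable; regularity of [steps_op j] absorbs this. *)
Lemma calA_factor j u : (j <= N)%N ->
  (forall l, (l <= j)%N -> ~ step_stops A0 A B l) -> L2 u ->
  eqL2 (calA A0 A B u) (steps_op j (remainder_op j u)).
Proof.
elim: j => [|j IH] jN ns uL.
  by apply: eqL2_pointwise => k kc; rewrite calA_remainder//; exact: ns.
have ns' l : (l <= j)%N -> ~ step_stops A0 A B l.
  by move=> lj; apply: ns; exact: leqW.
apply: (ae_eq_trans (IH (ltnW jN) ns' uL)) => /=.
have [_ _ se _] := regular_steps_op (ltnW jN) ns'.
have rq := regular_remainder_op (ltnW jN) ns'.
have rq' := regular_remainder_op jN ns.
have rs : regular_op (step_op j.+1) by apply: regular_step_op.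
apply: se.
- by case/L2E: (L2_regular rq uL).
- by case/L2E: (L2_regular rs (L2_regular rq' uL)).
have /L2E[um uoo] := uL.
apply: filterS (ae_slice_integrable jN um uoo) => k iu kc.
by apply: remainder_step => //; exact: iu.
Qed.

Lemma regular_calA : regular_op (calA A0 A B).
Proof.
apply: (@regular_op_add _ _ _ _ (fun u k => A0 k *m u k)
  (fun u k => \sum_(1 <= j < N.+1) avg_op j (A j) (B j) u k)).
  exact: regular_op_mul.
apply: regular_op_sum => i; rewrite mem_index_iota ltnS => /[dup] iN /andP[_ iN'].
by apply: regular_op_avg_op => //; [exact: Ac|exact: Bc].
Qed.

Lemma steps_op_inverse j : (j <= N)%N ->
  (forall l, (l <= j)%N -> ~ step_stops A0 A B l) ->
  exists S, regular_inverse (steps_op j) S.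
Proof.
elim: j => [|j IH] jN ns.
  exists (fun u k => invmx (A0 k) *m u k); apply: regular_inverse_mul => //.
  exact: (step_det_neq0 (ns 0 _)).
have ns' l : (l <= j)%N -> ~ step_stops A0 A B l.
  by move=> lj; apply: ns; exact: leqW.
have [S rS] := IH (ltnW jN) ns'.
have Xc : continuous_mx (red j.+1 j) by apply: continuous_mx_reduced => //; exact: ltnW.
have rP := regular_inverse_avg_update jN Xc (Bc (j := j.+1) jN)
  (step_det_neq0 (ns j.+1 (leqnn _))).
by eexists; exact: (regular_inverse_comp rS rP).
Qed.

Lemma calA_invertible :
  (forall j, (j <= N)%N -> ~ step_stops A0 A B j) -> invertible (calA A0 A B).
Proof.
move=> ns; have [S [rT rS TS]] := steps_op_inverse (leqnn N) ns.
have eT u : L2 u -> eqL2 (calA A0 A B u) (steps_op N u).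
  move=> uL; have := calA_factor (leqnn N) ns uL.
  by rewrite (_ : remainder_op N u = u)//; apply/funext => k;
    rewrite /remainder_op big_geq// addr0.
exists S; first exact: regular_bounded_operator.
move=> u uL; split; last first.
  exact: (ae_eq_trans (eT _ (L2_regular rS uL)) (TS u uL).2).
apply: (ae_eq_trans _ (TS u uL).1).
have [_ _ Se _] := rS; apply: Se; last exact: eT.
  by case/L2E: (L2_regular regular_calA uL).
by case/L2E: (L2_regular rT uL).
Qed.

End Factorization.

(** * Localized test functions *)

Section TestFunctions.
Context {R : realType} {N : nat}.
Local Notation C := (Cplx R).
Local Notation vfun p := (N.-tuple R -> 'cV[C]_p).
Local Notation mfun p q := (N.-tuple R -> 'M[C]_(p, q)).
Variables (j : nat) (k0 : N.-tuple R).
Hypothesis k0c : cube k0.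

Let mC : measurable (cube : set (N.-tuple R)). Proof. exact: measurable_cube. Qed.

(** Tuples are indexed from 0, so the constrained indices [i >= j] are the variables k_{j+1}, ...,
    k_N. *)
Definition near_box (d : R) : set (N.-tuple R) :=
  box (fun i : 'I_N => if (i < j)%N then setT else ball (tnth k0 i) d).

Definition bump (d : R) (k : N.-tuple R) : R := \1_(near_box d) k.

(** The unit in which all energies of test functions are measured; being positive and finite, it can
    be cancelled from the final inequality. *)
Definition vol (d : R) : \bar R := (\int[leb N]_(k in cube) (bump d k)%:E)%E.

Lemma measurable_near_box d : measurable (near_box d).
Proof.
by apply: measurable_box => i; case: ifP => // _; exact: measurable_ball.
Qed.

Lemma bump_ge0 d k : 0 <= bump d k.
Proof. by rewrite /bump indicE. Qed.

Lemma measurable_bump d : measurable_fun cube (bump d).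
Proof. by apply: measurable_indic; exact: measurable_near_box. Qed.

Lemma bump_slice_constant d (t : j.-tuple R) k :
  bump d (set_prefix t k) = bump d k.
Proof.
rewrite /bump !indicE; congr (_%:R); congr nat_of_bool.
apply/idP/idP => /set_mem kB; apply/mem_set => i; have := kB i.
all: rewrite tnth_set_prefix; case: ifPn => //; rewrite -leqNgt => ji.
all: by rewrite nth_default ?size_tuple.
Qed.

Lemma volE d : vol d = leb N (near_box d `&` cube).
Proof. by rewrite /vol integral_indic//; exact: measurable_near_box. Qed.

Lemma vol_lty d : (vol d < +oo)%E.
Proof.
rewrite volE (@le_lt_trans _ _ 1%E) ?ltry// -(leb_cube N); apply: le_measure => //.
- by rewrite inE; apply: measurableI => //; exact: measurable_near_box.
- by rewrite inE.
Qed.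

Lemma box_setI n (J J' : 'I_n -> set R) :
  box J `&` box J' = box (fun i => J i `&` J' i).
Proof.
apply/seteqP; split => [k [kJ kJ'] i|k kJ]; first by split; [exact: kJ|exact: kJ'].
by split => i; have [] := kJ i.
Qed.

Lemma vol_gt0 d : 0 < d -> (0 < vol d)%E.
Proof.
move=> d0; rewrite volE cubeE box_setI leb_box; last first.
  by move=> i; apply: measurableI => //; case: ifP => // _; exact: measurable_ball.
apply: (big_ind (fun x => 0 < x)%E) => // [x y x0 y0|i _]; first exact: mule_gt0.
case: ifPn => _.
  by rewrite setTI lebesgue_measure_itv /= lte_fin ltr01 oppr0 adde0.
set a := tnth k0 i; have /andP[a0 a1] : 0 <= a <= 1 by exact: k0c.
(* The point [k0] may lie on the boundary of the cube, so the part of the ball inside [0,1] is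
   bounded below by this interval. *)
have lo : Num.max 0 (a - d) < Num.min 1 (a + d).
  rewrite lt_min !gt_max; apply/andP; split; apply/andP; split; lra.
apply: (@lt_le_trans _ _ (lebesgue_measure
   (`]Num.max 0 (a - d), Num.min 1 (a + d)[%classic : set R))).
  by rewrite lebesgue_measure_itv /= lte_fin lo -EFinB lte_fin subr_gt0.
apply: le_measure; rewrite ?inE//.
  by apply: measurableI => //; exact: measurable_ball.
move=> x /=; rewrite !in_itv /= gt_max lt_min => /andP[/andP[x0 xd] /andP[x1 xd']].
split; last by rewrite !ltW.
by rewrite /ball /= ltr_distlC; apply/andP; split; lra.
Qed.

(* The first coordinate beyond [j] is averaged over a set of length [2 d]. *)
Lemma prefix_bump_le d i k : 0 < d -> (j < i <= N)%N -> cube k ->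
  (\int[leb i]_(t in cube) (bump d (set_prefix t k))%:E <= (2 * d)%:E)%E.
Proof.
move=> d0 /andP[ji iN] kc; have mCi := @measurable_cube R i.
have jN : (j < N)%N by exact: leq_trans iN.
set a := tnth k0 (Ordinal jN).
(* The constraint on k_{j+1}, which has index [j], is kept and the others are dropped. *)
pose J (l : 'I_i) : set R := if l == Ordinal ji then ball a d else setT.
have mJ l : measurable (J l) by rewrite /J; case: ifP => // _; exact: measurable_ball.
apply: (@le_trans _ _ (\int[leb i]_(t in cube) (\1_(box J) t)%:E)%E).
  apply: ge0_le_integral => //.
  - by move=> t _; rewrite lee_fin bump_ge0.
  - apply/measurable_EFinP; exact: (measurable_fun_set_prefix kc (@measurable_bump d)).
  - by apply/measurable_EFinP; apply: measurable_indic; exact: measurable_box.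
  move=> t tc; rewrite lee_fin /bump !indicE.
  have [/set_mem kB|//] := boolP (_ \in near_box d).
  rewrite mem_set// => l; rewrite /J; case: eqP => // ->.
  have := kB (Ordinal jN); rewrite /= ltnn tnth_set_prefix /=.
  by rewrite [tnth t _](tnth_nth (tnth k (Ordinal jN))).
rewrite integral_indic//; last exact: measurable_box.
rewrite -[X in (X <= _)%E]/(leb i (box J `&` cube)) cubeE box_setI leb_box;
  last by move=> l; exact: measurableI.
rewrite (bigD1 (Ordinal ji))//= big1 ?mule1; last first.
  move=> l /negbTE lj; rewrite /J lj setTI lebesgue_measure_itv /= lte_fin ltr01.
  by rewrite oppr0 adde0.
rewrite /J eqxx; apply: (@le_trans _ _ (lebesgue_measure (ball a d))).
  apply: le_measure; rewrite ?inE//; last exact: measurable_ball.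
  by apply: measurableI => //; exact: measurable_ball.
by rewrite (lebesgue_measure_ball _ (ltW d0)) mulr_natl.
Qed.

(** Overwriting the coordinates of index [>= j] by those of [k0] moves a point of the box by less
    than [d] and leads to a zero of [F]; uniform continuity concludes. *)
Lemma near_box_small p (F : vfun p) : continuous_mx F ->
  (forall k, cube k -> (forall i : 'I_N, (j <= i)%N -> tnth k i = tnth k0 i) ->
    F k = 0) ->
  forall e : R, 0 < e -> exists2 d0, 0 < d0 & forall d, d <= d0 ->
    forall k, cube k -> near_box d k -> sqnorm (F k) <= e.
Proof.
move=> Fc F0 e e0.
(* The sum of [p] squares of size at most e/(p+1) is below [e]; the successor avoids a division by
   0. *)
pose f := Num.sqrt (e / p.+1%:R).
have p0 : 0 < p.+1%:R :> R by rewrite ltr0n.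
have f0 : 0 < f by rewrite sqrtr_gt0 divr_gt0.
have [d0 d00 dP] := continuous_mx_unif Fc f0.
exists d0 => // d dd0 k kc kB.
pose k' : N.-tuple R := [tuple if (i < j)%N then tnth k i else tnth k0 i | i < N].
have k'c : cube k' by move=> i; rewrite tnth_mktuple; case: ifP => _; [exact: kc|exact: k0c].
have kk' : dist_lt d0 k k'.
  move=> i; rewrite tnth_mktuple; have := kB i; case: ifP => _ ki.
    by rewrite subrr normr0.
  by rewrite distrC; exact: lt_le_trans dd0.
have F'0 : F k' = 0.
  by apply: F0 => // i ji; rewrite tnth_mktuple ltnNge ji.
apply: (@le_trans _ _ (p%:R * f ^+ 2)).
  rewrite -[p in p%:R]card_ord -sum1_card natr_sum mulr_suml.
  apply: ler_sum => i _; rewrite mul1r ler_pXn2r ?nnegrE ?cabs_ge0 ?ltW//.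
  by have := dP _ _ kc k'c kk' i 0; rewrite F'0 mxE subr0.
rewrite sqr_sqrtr; last by rewrite ltW// divr_gt0.
by rewrite mulrC -mulrA ger_pMr// mulrC ler_pdivrMr// mul1r ler_nat.
Qed.

Definition test_fun p (F : vfun p) (d : R) : vfun p :=
  fun k => (bump d k)%:C%C *: F k.

Lemma sqnorm_test_fun p (F : vfun p) d k :
  sqnorm (test_fun F d k) = bump d k * sqnorm (F k).
Proof.
rewrite sqnormZ cabs_sqr /= expr0n /= addr0 /bump indicE.
by case: (_ \in _); rewrite /= ?expr1n ?expr0n.
Qed.

Lemma vmeas_test_fun p (F : vfun p) d : continuous_mx F -> vmeas (test_fun F d).
Proof.
move=> Fc i; apply: (@cmeas_ext _ _ (fun k => (bump d k)%:C%C * F k i 0)).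
  by move=> k _; rewrite mxE.
apply: cmeasM; last exact: (continuous_cube_cmeas (Fc i 0)).
by split; [exact: measurable_bump|exact: measurable_cst].
Qed.

Lemma vol_cst d (c : R) : 0 <= c ->
  (\int[leb N]_(k in cube) (c * bump d k)%:E = c%:E * vol d)%E.
Proof.
move=> c0; rewrite /vol -ge0_integralZl_EFin//.
- by move=> k _; rewrite lee_fin bump_ge0.
- by apply/measurable_EFinP; exact: measurable_bump.
Qed.

Lemma energy_le_vol p (u : vfun p) d (c : R) : 0 <= c -> vmeas u ->
  (forall k, cube k -> sqnorm (u k) <= c * bump d k) -> (energy u <= c%:E * vol d)%E.
Proof.
move=> c0 um uc; rewrite -vol_cst//; apply: ge0_le_integral => //.
- by move=> k _; rewrite lee_fin sqnorm_ge0.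
- exact: emeasurable_sqnorm.
- apply/measurable_EFinP; apply: measurable_funM => //; exact: measurable_bump.
Qed.

Lemma vol_le_energy p (u : vfun p) d (c : R) : 0 <= c -> vmeas u ->
  (forall k, cube k -> c * bump d k <= sqnorm (u k)) -> (c%:E * vol d <= energy u)%E.
Proof.
move=> c0 um uc; rewrite -vol_cst//; apply: ge0_le_integral => //.
- by move=> k _; rewrite lee_fin mulr_ge0// bump_ge0.
- apply/measurable_EFinP; apply: measurable_funM => //; exact: measurable_bump.
- exact: emeasurable_sqnorm.
Qed.

Lemma L2_test_fun p (F : vfun p) d : continuous_mx F -> L2 (test_fun F d).
Proof.
move=> Fc; apply/L2E; split; first exact: vmeas_test_fun.
have [K K0 FK] := continuous_mx_bounded Fc.
have c0 : 0 <= p%:R * K ^+ 2 by rewrite mulr_ge0 ?sqr_ge0.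
apply: (@le_lt_trans _ _ ((p%:R * K ^+ 2)%:E * vol d)%E); last first.
  by rewrite lte_mul_pinfty ?lee_fin// vol_lty.
apply: energy_le_vol => //; first exact: vmeas_test_fun.
move=> k kc; rewrite sqnorm_test_fun mulrC ler_wpM2r ?bump_ge0//.
rewrite -[p in p%:R]card_ord -sum1_card natr_sum mulr_suml.
apply: ler_sum => i _; rewrite mul1r ler_pXn2r ?nnegrE ?cabs_ge0 ?(ltW K0)//.
exact: FK.
Qed.

Lemma avg_test_fun p q (Y : mfun q p) (F : vfun p) d k : cube k ->
  continuous_mx Y -> continuous_mx F ->
  avg j (fun k => Y k *m test_fun F d k) k =
  test_fun (avg j (fun k => Y k *m F k)) d k.
Proof.
move=> kc Yc Fc; rewrite /test_fun -avgZ; last first.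
  exact: (continuous_mx_slice_integrable j kc (continuous_mxM Yc Fc)).
by apply: avg_ext => t tc; rewrite bump_slice_constant scalemxAr.
Qed.

(** Let I(k) be the integral of the bump over the slice in [i > j] variables. If |Y F| <= K, the
    average is at most 2 K I(k) in each entry. Now I <= 2 d by [prefix_bump_le], and I integrates to
    the volume, so the integral of I^2 is at most 2 d times the volume. *)
Lemma energy_avg_test_fun p q i (Y : mfun q p) (F : vfun p) : (j < i <= N)%N ->
  continuous_mx Y -> continuous_mx F ->
  exists2 c : R, 0 <= c & forall d, 0 < d ->
    (energy (avg i (fun k => Y k *m test_fun F d k)) <= (c * d)%:E * vol d)%E.
Proof.
move=> /[dup] jiN /andP[ji iN] Yc Fc; have mCi := @measurable_cube R i.
have YFc := continuous_mxM Yc Fc.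
have [K K0 YFK] := continuous_mx_bounded YFc.
have qK0 : 0 <= q%:R * (2 * K) ^+ 2 * 2.
  by apply: mulr_ge0 => //; apply: mulr_ge0 => //; exact: sqr_ge0.
exists (q%:R * (2 * K) ^+ 2 * 2) => //.
move=> d d0; set u := fun k => Y k *m test_fun F d k.
have uE k : u k = test_fun (fun k => Y k *m F k) d k.
  by rewrite /u /test_fun scalemxAr.
have um : vmeas u.
  rewrite (_ : u = test_fun (fun k => Y k *m F k) d); last exact/funext/uE.
  exact: vmeas_test_fun.
have c0 : 0 <= q%:R * (2 * K) ^+ 2 * 2 * d by apply: mulr_ge0 => //; exact: ltW.
pose I k := (\int[leb i]_(t in cube) (bump d (set_prefix t k))%:E)%E.
have mb : measurable_fun cube (fun k => (bump d k)%:E).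
  by apply/measurable_EFinP; exact: measurable_bump.
have mI : measurable_fun cube I.
  apply: (@measurable_prefix_integral _ i N (fun k => (bump d k)%:E)) => //.
  by move=> k _; rewrite lee_fin bump_ge0.
have I0 k : (0 <= I k)%E by apply: integral_ge0 => t _; rewrite lee_fin bump_ge0.
have -> : vol d = (\int[leb N]_(k in cube) I k)%E.
  rewrite (@ge0_integral_prefix _ i N (fun k => (bump d k)%:E))//.
  by move=> k _; rewrite lee_fin bump_ge0.
rewrite -ge0_integralZl_EFin//.
apply: ge0_le_integral => //.
- by move=> k _; rewrite lee_fin sqnorm_ge0.
- by apply: emeasurable_sqnorm; exact: vmeas_avg.
- exact: measurable_funeM.
move=> k kc; have Id := prefix_bump_le d0 jiN kc.
have Ifin : (I k = (fine (I k))%:E)%E.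
  by rewrite fineK// ge0_fin_numE// (le_lt_trans Id)// ltry.
set r := fine (I k) in Ifin.
have r0 : 0 <= r by rewrite -lee_fin -Ifin.
have rd : r <= 2 * d by rewrite -lee_fin -Ifin.
have ib : (leb i).-integrable cube
    (EFin \o (fun t : i.-tuple R => K * bump d (set_prefix t k))).
  rewrite /comp; under eq_fun do rewrite EFinM.
  apply: integrableZl => //; apply/integrableP; split.
    apply/measurable_EFinP; exact: (measurable_fun_set_prefix kc (@measurable_bump d)).
  rewrite (_ : (\int[_]_(_ in _) _)%E = I k); first by rewrite Ifin ltry.
  by apply: eq_integral => t _; rewrite gee0_abs// lee_fin bump_ge0.
have Kr : \int[leb i]_(t in cube) (K * bump d (set_prefix t k)) = K * r.
  rewrite /Rintegral; under eq_integral do rewrite EFinM.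
  rewrite ge0_integralZl_EFin ?(ltW K0)//.
  - by rewrite -/(I k) Ifin.
  - by move=> t _; rewrite lee_fin bump_ge0.
  - apply/measurable_EFinP; exact: (measurable_fun_set_prefix kc (@measurable_bump d)).
have us a (t : i.-tuple R) : cube t ->
    cabs (u (set_prefix t k) a 0) <= K * bump d (set_prefix t k).
  move=> tc; rewrite uE mxE cabsM mulrC ler_pM ?cabs_ge0//.
    by apply: YFK; exact: cube_set_prefix.
  rewrite /cabs normc_def /= expr0n /= addr0 sqrtr_sqr.
  by rewrite ger0_norm ?bump_ge0.
have ui a : cintegrable (fun t : i.-tuple R => u (set_prefix t k) a 0).
  apply: (@cintegrable_bounded _ _ _ K).
    exact: (cmeas_slice kc (um a)).
  move=> t tc; apply: le_trans (us a t tc) _.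
  by rewrite ler_piMr ?(ltW K0)// /bump indicE lern1 leq_b1.
have au a : cabs (avg i u k a 0) <= 2 * (K * r).
  by rewrite mxE -Kr; apply: cabs_cube_integral_le => // t tc; exact: us.
rewrite Ifin -EFinM lee_fin.
apply: (@le_trans _ _ (q%:R * (2 * (K * r)) ^+ 2)).
  rewrite -[q in q%:R]card_ord -sum1_card natr_sum mulr_suml.
  apply: ler_sum => a _; rewrite mul1r ler_pXn2r ?nnegrE ?cabs_ge0//.
  by rewrite !mulr_ge0// ltW.
(* One factor [r] supplies the small [d]; the other is kept to rebuild [vol d] by integration. *)
have r2 : r ^+ 2 <= 2 * d * r by rewrite expr2 ler_wpM2r.
have -> : (2 * (K * r)) ^+ 2 = (2 * K) ^+ 2 * r ^+ 2 by rewrite mulrA exprMn.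
have -> : q%:R * (2 * K) ^+ 2 * 2 * d * r = q%:R * ((2 * K) ^+ 2 * (2 * d * r)).
  by rewrite !mulrA.
by rewrite ler_wpM2l// ler_wpM2l// sqr_ge0.
Qed.

Lemma energy_sum_avg_test_fun p (m : nat -> nat) (s : seq nat)
    (X : forall i, mfun p (m i)) (Y : forall i, mfun (m i) p) (F : vfun p) :
  (forall i, i \in s -> [/\ (j < i <= N)%N, continuous_mx (X i) & continuous_mx (Y i)]) ->
  continuous_mx F ->
  exists2 c : R, 0 <= c & forall d, 0 < d ->
    (energy (fun k => (\sum_(i <- s) avg_op i (X i) (Y i) (test_fun F d) k)%R) <=
     (c * d)%:E * vol d)%E.
Proof.
move=> + Fc; elim: s => [|i s IH] h.
  exists 0 => // d d0; rewrite mul0r mul0e /energy integral0_eq// => k _.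
  by congr EFin; apply/eqP; rewrite sqnorm_eq0 big_nil.
have hs l : l \in s -> [/\ (j < l <= N)%N, continuous_mx (X l) & continuous_mx (Y l)].
  by move=> ls; apply: h; rewrite in_cons ls orbT.
have rl l : l \in s -> regular_op (avg_op l (X l) (Y l)).
  by move=> /hs[/andP[_ lN] ? ?]; exact: regular_op_avg_op.
have [iN Xc Yc] := h i (mem_head _ _).
have [c c0 cP] := IH hs.
have [c1 c10 c1P] := energy_avg_test_fun iN Yc Fc.
have [c2 c20 c2P] := energy_mulmx Xc.
exists (2 * (c2 * c1) + 2 * c); first by rewrite addr_ge0 ?mulr_ge0.
move=> d d0; have um := vmeas_test_fun d Fc.
have Yum : vmeas (avg i (fun k => Y i k *m test_fun F d k)).
  apply: vmeas_avg; apply: vmeas_mulmx => //.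
  by move=> a b; exact: (continuous_cube_cmeas (Yc a b)).
have im : vmeas (avg_op i (X i) (Y i) (test_fun F d)).
  apply: vmeas_mulmx Yum.
  by move=> a b; exact: (continuous_cube_cmeas (Xc a b)).
have [sm _ _ _] := regular_op_sum rl.
rewrite (_ : (fun k => _) = (fun k => avg_op i (X i) (Y i) (test_fun F d) k +
   \sum_(l <- s) avg_op l (X l) (Y l) (test_fun F d) k)); last first.
  by apply/funext => k; rewrite big_cons.
apply: le_trans (energy_D im (sm _ um)) _.
have vd0 : (0 <= vol d)%E by rewrite ltW// vol_gt0.
have e1 : (energy (avg_op i (X i) (Y i) (test_fun F d)) <=
    (c2 * (c1 * d))%:E * vol d)%E.
  apply: le_trans (c2P _ Yum) _.
  by rewrite EFinM -muleA lee_wpmul2l ?lee_fin// c1P.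
apply: (@le_trans _ _ (2%:E * ((c2 * (c1 * d))%:E * vol d) +
    2%:E * ((c * d)%:E * vol d))%E).
  by rewrite leeD// lee_wpmul2l ?lee_fin// cP.
rewrite !muleA -!EFinM -ge0_muleDl ?lee_fin ?mulr_ge0 ?(ltW d0)//.
rewrite -EFinD; apply: lee_wpmul2r => //.
by rewrite lee_fin le_eqVlt; apply/orP; left; apply/eqP; ring.
Qed.

End TestFunctions.

(** * Non-invertibility *)

Section NonInvertibility.
Context {R : realType} {N : nat}.
Local Notation C := (Cplx R).
Local Notation vfun p := (N.-tuple R -> 'cV[C]_p).
Local Notation mfun p q := (N.-tuple R -> 'M[C]_(p, q)).

Lemma energy_ae_eq p (u v : vfun p) : vmeas u -> vmeas v -> eqL2 u v -> energy u = energy v.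
Proof.
move=> um vm uv; apply: ge0_ae_eq_integral => //.
- exact: measurable_cube.
- exact: emeasurable_sqnorm.
- exact: emeasurable_sqnorm.
- by move=> k _; rewrite lee_fin sqnorm_ge0.
- by move=> k _; rewrite lee_fin sqnorm_ge0.
- by apply: filterS uv => k uv kc; rewrite uv.
Qed.

Lemma eq_energy p (u v : vfun p) : (forall k, cube k -> u k = v k) -> energy u = energy v.
Proof. by move=> uv; apply: eq_integral => k /set_mem kc; rewrite uv. Qed.

Lemma invertible_energy p (T : vfun p -> vfun p) : regular_op T -> invertible T ->
  exists2 c : R, 0 <= c & forall u, L2 u -> (energy u <= c%:E * energy (T u))%E.
Proof.
(* The constant in [bounded_operator] carries no sign, whence the absolute value. *)
move=> rT [S [SL _ _ [c cS]] ST]; exists (`|c| ^+ 2); first exact: sqr_ge0.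
move=> u uL; have TuL := L2_regular rT uL; have STuL := SL _ TuL.
have /L2E[um _] := uL; have /L2E[STum _] := STuL.
rewrite (energy_ae_eq um STum (ae_eq_sym (ST u uL).1)).
apply/L2norm_le => //; apply: le_trans (cS _ TuL) _.
by rewrite lee_wpmul2r ?lee_fin ?ler_norm//; exact: Lnorm_ge0.
Qed.

(** * Operators that are small on localized test functions *)

Section TestFunctionEstimate.
Variables (j : nat) (k0 : N.-tuple R) (p : nat) (m : nat -> nat) (s : seq nat).
Variables (X : forall i, mfun p (m i)) (Y : forall i, mfun (m i) p) (F G : vfun p).
Variable T : vfun p -> vfun p.
Hypotheses (k0c : cube k0) (Fc : continuous_mx F) (Gc : continuous_mx G)
  (sXY : forall i, i \in s -> [/\ (j < i <= N)%N, continuous_mx (X i) & continuous_mx (Y i)])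
  (G0 : forall k, cube k ->
    (forall i : 'I_N, (j <= i)%N -> tnth k i = tnth k0 i) -> G k = 0)
  (TE : forall d k, cube k -> T (test_fun j k0 F d) k = test_fun j k0 G d k +
    \sum_(i <- s) avg_op i (X i) (Y i) (test_fun j k0 F d) k).

(** The setting covers every step of the procedure: F = v, G = A_0 v and T = [calA] at step 0; F = X
    v, G = X E v and T the preceding remainder at later steps. *)
Lemma energy_op_test_fun (e : R) : 0 < e -> exists2 d0, 0 < d0 &
  forall d, 0 < d <= d0 ->
    (energy (T (test_fun j k0 F d)) <= e%:E * vol j k0 d)%E.
Proof.
move=> e0.
(* After doubling by [energy_D], the term with [G] costs e/4, and the averages cost 2 c d <= e/2 as
   soon as d <= e / (4 (c + 1)). *)
have e80 : 0 < e / 8 by rewrite divr_gt0.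
have [d1 d10 d1P] := near_box_small k0c Gc G0 e80.
have [c c0 cP] := energy_sum_avg_test_fun k0c sXY Fc.
have c10 : 0 < 4 * (c + 1) by rewrite mulr_gt0// ltr_wpDl.
exists (Num.min d1 (e / (4 * (c + 1)))); first by rewrite lt_min d10 divr_gt0.
move=> d; rewrite le_min => /and3P[d0 dd1 de].
rewrite (eq_energy (TE d)).
have v0 : (0 <= vol j k0 d)%E by rewrite ltW// vol_gt0.
have rl i : i \in s -> regular_op (avg_op i (X i) (Y i)).
  by move=> /sXY[/andP[_ iN] ? ?]; exact: regular_op_avg_op.
have [sm _ _ _] := regular_op_sum rl.
have Fm := vmeas_test_fun j k0 d Fc.
have Gm := vmeas_test_fun j k0 d Gc.
apply: le_trans (energy_D Gm (sm _ Fm)) _.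
have eG : (energy (test_fun j k0 G d) <= (e / 8)%:E * vol j k0 d)%E.
  apply: energy_le_vol => //; first exact: ltW.
  move=> k kc; rewrite sqnorm_test_fun /bump indicE.
  have [/set_mem kB|_] := boolP (k \in near_box j k0 d); last by rewrite mul0r mulr0.
  by rewrite mul1r mulr1; exact: (d1P d).
apply: (@le_trans _ _ (2%:E * ((e / 8)%:E * vol j k0 d) +
    2%:E * ((c * d)%:E * vol j k0 d))%E).
  by rewrite leeD// lee_wpmul2l ?lee_fin// cP.
have e8ge : 0 <= 2 * (e / 8) by rewrite mulr_ge0// ltW.
have cdge : 0 <= 2 * (c * d) by rewrite !mulr_ge0// ltW.
rewrite !muleA -!EFinM -ge0_muleDl ?lee_fin// -EFinD lee_wpmul2r// lee_fin.
have : d * (4 * (c + 1)) <= e by rewrite -ler_pdivlMr.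
by nra.
Qed.

(** Writing u for the test function and V for its volume, a V <= c energy(u) <= c D energy(T u) <= c
    D e V for every e > 0 and small d. Cancelling V contradicts a > 0. *)
Lemma not_bounded_below (a c D : R) : 0 < a -> 0 <= c -> 0 <= D ->
  (exists2 d0, 0 < d0 & forall d, 0 < d <= d0 ->
    (a%:E * vol j k0 d <= c%:E * energy (test_fun j k0 F d))%E) ->
  (forall u, L2 u -> (energy u <= D%:E * energy (T u))%E) -> False.
Proof.
move=> a0 c0 D0 [d0 d00 low] TD.
have cD0 : 0 < 2 * (c * D + 1) by rewrite mulr_gt0// ltr_wpDl// mulr_ge0.
(* Chosen so that c D e < a, also when c D = 0. *)
have e0 : 0 < a / (2 * (c * D + 1)) by rewrite divr_gt0.
have [d1 d10 up] := energy_op_test_fun e0.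
pose d := Num.min d0 d1.
have dgt0 : 0 < d by rewrite lt_min d00.
have dd0 : 0 < d <= d0 by rewrite dgt0 ge_min lexx.
have dd1 : 0 < d <= d1 by rewrite dgt0 ge_min lexx orbT.
have h : (a%:E * vol j k0 d <=
    (c * (D * (a / (2 * (c * D + 1)))))%:E * vol j k0 d)%E.
  apply: le_trans (low d dd0) _; rewrite EFinM -muleA lee_wpmul2l ?lee_fin//.
  apply: le_trans (TD _ (L2_test_fun j k0 d Fc)) _.
  by rewrite EFinM -muleA lee_wpmul2l ?lee_fin// up.
have v0 := vol_gt0 j k0c dgt0; have vfin := vol_lty j k0 d.
have vE : (vol j k0 d = (fine (vol j k0 d))%:E)%E.
  by rewrite fineK// ge0_fin_numE// ltW.
move: h v0; rewrite vE -!EFinM lee_fin lte_fin => h v0.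
move: h; rewrite ler_pM2r//; apply/negP; rewrite -ltNge.
rewrite (_ : _ * _ = a * ((c * D) / (2 * (c * D + 1)))); last by ring.
rewrite gtr_pMr// ltr_pdivrMr// mul1r.
by have := mulr_ge0 c0 D0; lra.
Qed.

End TestFunctionEstimate.

(** An average over the first [j] variables depends on the others alone; a kernel vector of E_j at
    k^0 is thus one at every point with the same k_{j+1}, ..., k_N. *)
Lemma avg_agree p q j (F : mfun p q) k k' : (j <= N)%N ->
  (forall i : 'I_N, (j <= i)%N -> tnth k i = tnth k' i) -> avg j F k = avg j F k'.
Proof.
move=> jN kk'; apply/matrixP => a b; rewrite !mxE.
apply: cube_integral_ext => t _; congr (F _ a b).
apply: eq_from_tnth => i; rewrite !tnth_set_prefix.
have [ij|ij] := ltnP i j; first by rewrite -!(tnth_nth _ t (Ordinal ij)).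
by rewrite !nth_default ?size_tuple// kk'.
Qed.

Lemma det0_kernel n (E : 'M[C]_n) : \det E = 0 ->
  exists2 v : 'cV[C]_n, v != 0 & E *m v = 0.
Proof.
move=> E0; have /det0P[w w0 wE] : \det E^T == 0 by rewrite det_tr E0.
exists w^T; first by rewrite -(inj_eq trmx_inj) trmxK trmx0.
by apply: trmx_inj; rewrite trmx_mul trmxK wE trmx0.
Qed.

Section Stops.
Context {M : nat} (m : nat -> nat).
Variables (A0 : mfun M M) (A : forall j, mfun M (m j)) (B : forall j, mfun (m j) M).
Hypotheses (A0c : continuous_mx A0)
  (Ac : forall j, (1 <= j <= N)%N -> continuous_mx (A j))
  (Bc : forall j, (1 <= j <= N)%N -> continuous_mx (B j)).

Local Notation red := (reduced A0 A B).

Lemma calA_not_invertible0 : step_stops A0 A B 0 -> ~ invertible (calA A0 A B).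
Proof.
move=> [k0 k0c /det0_kernel[v v0 A0v]] /(invertible_energy (regular_calA A0c Ac Bc)).
move=> [D D0 TD].
have Fc : continuous_mx (fun _ : N.-tuple R => v) by exact: continuous_mx_cst.
have Gc : continuous_mx (fun k => A0 k *m v) by exact: continuous_mxM.
have nv0 : 0 < sqnorm v by rewrite lt_def sqnorm_ge0 sqnorm_eq0 v0.
(* With [j = 0] the box constrains all variables, and the energy of f v is |v|^2 times the
   volume. *)
apply: (@not_bounded_below 0 k0 M m (index_iota 1 N.+1) A B _ _ (calA A0 A B)
  k0c Fc Gc _ _ _ (sqnorm v) 1 D nv0 ler01 D0 _ TD).
- move=> i; rewrite mem_index_iota ltnS => /[dup] iN /andP[i0 iN'].
  by rewrite i0 iN'; split => //; [exact: Ac|exact: Bc].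
- move=> k kc kk0; rewrite (_ : k = k0)//.
  by apply: eq_from_tnth => i; exact: kk0.
- by move=> d k kc; rewrite /calA /test_fun scalemxAr.
- exists 1 => // d _; rewrite mul1e; apply: vol_le_energy; first exact: ltW.
    exact: vmeas_test_fun.
  by move=> k kc; rewrite sqnorm_test_fun mulrC.
Qed.

(** The contradiction is derived for the remainder Q_j: the factor [steps_op j] is bounded, so a
    bound from below for [calA] passes to Q_j at the price of the constant of [steps_op j]. *)
Lemma calA_not_invertibleS j : (j < N)%N ->
  (forall i, (i <= j)%N -> ~ step_stops A0 A B i) ->
  step_stops A0 A B j.+1 -> ~ invertible (calA A0 A B).
Proof.
move=> jN ns [k0 k0c /= /det0_kernel[v v0 Ev0]].
move=> /(invertible_energy (regular_calA A0c Ac Bc))[D D0 AD].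
have Bjc : continuous_mx (B j.+1) by exact: Bc.
have [X XE] : {X | X = red j.+1 j} by exists (red j.+1 j).
have Xc : continuous_mx X by rewrite XE; apply: continuous_mx_reduced => //; exact: ltnW.
have [E EE] : {E | E = step_mx B X} by exists (step_mx B X).
have Ec : continuous_mx E by rewrite EE; exact: continuous_mx_step_mx.
have {}EE k : E k = 1%:M + avg j.+1 (fun k => B j.+1 k *m X k) k by rewrite EE.
have {}Ev0 : E k0 *m v = 0 by rewrite EE XE.
have vc : continuous_mx (fun _ : N.-tuple R => v) by exact: continuous_mx_cst.
have Evc : continuous_mx (fun k => E k *m v) := continuous_mxM Ec vc.
have Fc : continuous_mx (fun k => X k *m v) := continuous_mxM Xc vc.
have Gc : continuous_mx (fun k => X k *m (E k *m v)) := continuous_mxM Xc Evc.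
have nv0 : 0 < sqnorm v by rewrite lt_def sqnorm_ge0 sqnorm_eq0 v0.
(* Where |E v|^2 <= |v|^2 / 4, the inequality |v|^2 <= 2 |E v|^2 + 2 |v - E v|^2 gives |v - E v|^2
   >= |v|^2 / 4. *)
have nv40 : 0 < sqnorm v / 4 by rewrite divr_gt0.
have Ev k : (forall i : 'I_N, (j.+1 <= i)%N -> tnth k i = tnth k0 i) ->
    E k *m v = 0.
  by move=> kk0; rewrite EE (avg_agree _ jN kk0) -EE.
have avgBF k : cube k -> avg j.+1 (fun k => B j.+1 k *m (X k *m v)) k =
    E k *m v - v.
  move=> kc; have iX := continuous_mx_slice_integrable j.+1 kc (continuous_mxM Bjc Xc).
  have sv : slice_constant j.+1 (fun _ : N.-tuple R => v) k by [].
  transitivity (avg j.+1 (fun k => B j.+1 k *m X k) k *m v).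
    by rewrite -(avgMr iX sv); apply: avg_ext => t _; rewrite mulmxA.
  by rewrite EE mulmxDl mul1mx addrC addKr.
have avgBt d k : cube k ->
    avg j.+1 (fun k => B j.+1 k *m test_fun j.+1 k0 (fun k => X k *m v) d k) k =
    test_fun j.+1 k0 (fun k => E k *m v - v) d k.
  by move=> kc; rewrite avg_test_fun// /test_fun avgBF.
have rs := regular_steps_op A0c Ac Bc (ltnW jN) ns.
have rr := regular_remainder_op A0c Ac Bc (ltnW jN) ns.
have [_ [c c0 sc] _ _] := rs.
(* The energy of <B_{j+1} u>_{j+1} is at most [c1] times that of u, so bounding this average from
   below bounds u from below. *)
have [_ [c1 c10 c1P] _ _] := regular_op_comp (regular_op_mul Bjc)
  (regular_op_avg (m j.+1) jN).
apply: (@not_bounded_below j.+1 k0 M m (index_iota j.+2 N.+1) (fun i => red i j) B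
  _ _ (remainder_op A0 A B j) k0c Fc Gc _ _ _ (sqnorm v / 4) c1 (D * c) nv40 c10 _ _ _).
- move=> i; rewrite mem_index_iota ltnS => /andP[ji iN].
  have iN' : (1 <= i <= N)%N by rewrite iN (leq_trans _ ji).
  rewrite ji iN; split => //; last exact: Bc.
  by apply: continuous_mx_reduced => //; exact: ltnW.
- by move=> k kc kk0; rewrite Ev// mulmx0.
(* The term i = j+1 of the remainder equals f X (E v - v); added to f X v it leaves f X E v. *)
- move=> d k kc; rewrite /remainder_op big_ltn ?ltnS// -XE addrA; congr (_ + _).
  rewrite /avg_op avgBt// /test_fun -scalemxAr -scalerDr; congr (_ *: _).
  by rewrite mulmxBr addrC subrK.
- exact: mulr_ge0.
- have [d0 d00 d0P] := near_box_small k0c Evc (fun k _ => @Ev k) nv40.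
  exists d0 => // d /andP[dgt0 dd0].
  have tm := vmeas_test_fun j.+1 k0 d Fc.
  apply: le_trans (c1P _ tm); apply: vol_le_energy; first exact: ltW.
    apply: vmeas_avg; apply: vmeas_mulmx tm.
    by move=> a b; exact: (continuous_cube_cmeas (Bjc a b)).
  move=> k kc; rewrite avgBt// sqnorm_test_fun mulrC /bump indicE.
  have [/set_mem kB|_] := boolP (k \in near_box j.+1 k0 d); last by rewrite !mul0r.
  rewrite !mul1r; have := d0P d dd0 k kc kB.
  have := sqnormD (E k *m v) (v - E k *m v); rewrite addrC subrK.
  have -> : sqnorm (v - E k *m v) = sqnorm (E k *m v - v).
    rewrite -opprB -scaleN1r sqnormZ cabsN.
    by rewrite /cabs normr1 /= expr1n mul1r.
  by lra.
- move=> u uL; apply: le_trans (AD u uL) _.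
  have rL := L2_regular rr uL; have sL := L2_regular rs rL.
  have AL := L2_regular (regular_calA A0c Ac Bc) uL.
  have /L2E[rm _] := rL; have /L2E[sm _] := sL; have /L2E[Am _] := AL.
  rewrite (energy_ae_eq Am sm (calA_factor A0c Ac Bc (ltnW jN) ns uL)).
  by rewrite EFinM -muleA lee_wpmul2l ?lee_fin// sc.
Qed.

End Stops.
End NonInvertibility.

Theorem theorem1p4 (R : realType) (N M : nat) (m : nat -> nat)
    (A0 : N.-tuple R -> 'M[Cplx R]_(M, M))
    (A : forall j : nat, N.-tuple R -> 'M[Cplx R]_(M, m j))
    (B : forall j : nat, N.-tuple R -> 'M[Cplx R]_(m j, M))
    (N_gt0 : (0 < N)%N) (M_gt0 : (0 < M)%N)
    (m_gt0 : forall j : nat, (1 <= j <= N)%N -> (0 < m j)%N)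
    (A0_cont : continuous_on_cube A0)
    (A_cont : forall j : nat, (1 <= j <= N)%N -> continuous_on_cube (A j))
    (B_cont : forall j : nat, (1 <= j <= N)%N -> continuous_on_cube (B j)) :
  bounded_operator (calA A0 A B) /\
  (forall j : nat, (j <= N)%N ->
     (forall i : nat, (i < j)%N -> ~ step_stops A0 A B i) ->
     step_stops A0 A B j -> ~ invertible (calA A0 A B)) /\
  ((forall j : nat, (j <= N)%N -> ~ step_stops A0 A B j) ->
     invertible (calA A0 A B)).
Proof.
have A0c := continuous_on_cubeP A0_cont.
have Ac j (jN : (1 <= j <= N)%N) := continuous_on_cubeP (A_cont j jN).
have Bc j (jN : (1 <= j <= N)%N) := continuous_on_cubeP (B_cont j jN).
split; first exact/regular_bounded_operator/regular_calA.
split; last exact: calA_invertible.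
case=> [_ _|j jN ns]; first exact: calA_not_invertible0.
exact: calA_not_invertibleS.
Qed.
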